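(* Let $n\ge1$ and let $Z\subseteq\mathbb{R}^n$ be an $n$-dimensional zonoid. Then $$\operatorname{vol}_n(Z)\,\operatorname{vol}_n(Z^\circ)\ge\frac{4^n}{n!}.$$
   Context: A zonoid is a compact convex set $Z\subseteq\mathbb{R}^n$ whose support function has the form $h_Z(x)=\max_{z\in Z}\langle x,z\rangle=\int_{S^{n-1}}|\langle x,y\rangle|\,d\rho(y)$ for some even finite nonnegative Borel measure $\rho$ on the unit sphere $S^{n-1}$ (equivalently, $Z$ is an origin-symmetric limit, in the Hausdorff distance, of finite Minkowski sums of line segments). In particular $Z=-Z$. The polar body is $Z^\circ=\{y\in\mathbb{R}^n:\langle x,y\rangle\le1\text{ for all }x\in Z\}$. *)

(* Defs.v *)
From HB Require Import structures.
From mathcomp Require Import all_boot all_order all_algebra.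
From mathcomp Require Import all_classical all_reals all_analysis.

Set Implicit Arguments.
Unset Strict Implicit.
Unset Printing Implicit Defensive.

Import Order.TTheory GRing.Theory Num.Theory.
Import numFieldNormedType.Exports.

Local Open Scope classical_set_scope.
Local Open Scope ring_scope.

Section tuple_product_measure.
Context (R : realType) (n : nat).
Local Notation RT := (measurableTypeR R).
Variable mu : {sigma_finite_measure set (n.-tuple RT) -> \bar R}.

Definition tcons (p : RT * n.-tuple RT) : n.+1.-tuple RT :=
  [the n.+1.-tuple RT of p.1 :: p.2].

Lemma measurable_tcons : measurable_fun setT tcons.
Proof. exact: measurable_cons. Qed.

Definition lebesgue_cons : set (n.+1.-tuple RT) -> \bar R :=
  pushforward (@lebesgue_measure R \x mu)%E tcons.

Let lebesgue_cons0 : lebesgue_cons set0 = 0%E.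
Proof. by rewrite /lebesgue_cons /pushforward preimage_set0 measure0. Qed.

Let lebesgue_cons_ge0 A : (0 <= lebesgue_cons A)%E.
Proof. by rewrite /lebesgue_cons /pushforward; exact: measure_ge0. Qed.

Let lebesgue_cons_sigma_additive : semi_sigma_additive lebesgue_cons.
Proof.
move=> F mF tF mUF; rewrite /lebesgue_cons /pushforward preimage_bigcup.
have mp A : measurable A -> measurable (tcons @^-1` A).
  by move=> mA; rewrite -[X in measurable X]setTI; exact: measurable_tcons.
apply: measure_semi_sigma_additive.
- by move=> k; exact: mp.
- apply/trivIsetP => /= i j _ _ ij; rewrite -preimage_setI.
  by move/trivIsetP : tF => /(_ i j Logic.I Logic.I ij) ->; rewrite preimage_set0.
- by rewrite -preimage_bigcup; exact: mp.
Qed.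

HB.instance Definition _ := isMeasure.Build _ _ _ lebesgue_cons
  lebesgue_cons0 lebesgue_cons_ge0 lebesgue_cons_sigma_additive.

Let lebesgue_cons_sigma_finite : sigma_finite setT lebesgue_cons.
Proof.
have /sigma_finiteP[F [TF ndF Foo]] := sigma_finiteT (@lebesgue_measure R).
have /sigma_finiteP[G [TG ndG Goo]] := sigma_finiteT mu.
pose ucons (t : n.+1.-tuple RT) := (tnth t ord0, [tuple of behead t]).
have uconsK p : ucons (tcons p) = p.
  by case: p => x t; congr (_, _); apply: val_inj.
have mucons : measurable_fun setT ucons.
  by apply/measurable_fun_pair => //;
    [exact: measurable_tnth | exact: measurable_behead].
exists (fun k => ucons @^-1` (F k `*` G k)).
  rewrite -preimage_bigcup; apply/esym; rewrite -subTset => t _ /=.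
  have [i _ Fi] : (\bigcup_i F i) (ucons t).1 by rewrite -TF.
  have [j _ Gj] : (\bigcup_j G j) (ucons t).2 by rewrite -TG.
  exists (maxn i j) => //; split.
    by move: Fi; exact/subsetPset/ndF/leq_maxl.
  by move: Gj; exact/subsetPset/ndG/leq_maxr.
move=> k; have [mF Fk] := Foo k; have [mG Gk] := Goo k; split.
  rewrite -[X in measurable X]setTI; apply: mucons => //; exact: measurableX.
rewrite /lebesgue_cons /pushforward.
rewrite (_ : _ @^-1` _ = F k `*` G k); last first.
  by rewrite -comp_preimage (_ : _ \o _ = id)//; apply/funext => p; exact: uconsK.
by rewrite product_measure1E// lte_mul_pinfty// ge0_fin_numE.
Qed.

HB.instance Definition _ := Measure_isSigmaFinite.Build _ _ _ lebesgue_cons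
  lebesgue_cons_sigma_finite.

End tuple_product_measure.

(* The n-fold product of the Lebesgue measure of R with itself; for n = 0 it is
   the unit mass on the one-point space. *)
Fixpoint lebesgue_tuple (R : realType) (n : nat) :
    {sigma_finite_measure set (n.-tuple (measurableTypeR R)) -> \bar R} :=
  match n with
  | 0 => dirac [tuple]
  | m.+1 => lebesgue_cons (lebesgue_tuple R m)
  end.

Lemma lebesgue_tuple_box (R : realType) (n : nat)
    (A : 'I_n -> set (measurableTypeR R)) :
  (forall i, measurable (A i)) ->
  lebesgue_tuple R n [set t | forall i, A i (tnth t i)]
    = (\prod_(i < n) lebesgue_measure (A i))%E.
Proof.
elim: n A => [|n IHn] A mA /=.
  by rewrite big_ord0 diracE mem_set// => -[].
rewrite big_ord_recl -IHn//.
have mB : measurable [set t : n.-tuple (measurableTypeR R) |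
    forall i, A (lift ord0 i) (tnth t i)].
  rewrite (_ : [set _ | _] =
      \bigcap_(i in [set: 'I_n]) ((fun t => tnth t i) @^-1` A (lift ord0 i))).
    apply: fin_bigcap_measurable => // i _; rewrite -[X in measurable X]setTI.
    exact: measurable_tnth.
  by apply/seteqP; split => t /= h i; [move=> _; exact: h | exact: h].
rewrite -product_measure1E// /lebesgue_cons /pushforward; congr (_ _).
apply/seteqP; split => -[x t] /=.
  move=> h; split; first by have := h ord0.
  by move=> i; have := h (lift ord0 i); rewrite tnthS.
move=> [hx ht] i; case: (unliftP ord0 i) => [j|] -> //.
by rewrite tnthS; exact: ht.
Qed.

Section convex_bodies.
Context (R : realType) (n : nat).
Implicit Types (A Z : set 'rV[R]_n) (x y z : 'rV[R]_n).

Definition vol A : \bar R :=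
  lebesgue_tuple R n [set t | A (\row_i tnth t i)].

(* The library's norm on 'rV[R]_n is the sup norm, hence the explicit inner
   product and Euclidean sphere. *)
Definition dotp x y : R := \sum_i x ord0 i * y ord0 i.

Definition sphere : set 'rV[R]_n := [set x | Num.sqrt (dotp x x) = 1].

Definition borel_rV := g_sigma_algebraType (@open 'rV[R]_n).

(* A Borel measure on the sphere, seen as a Borel measure on R^n that charges
   only the sphere. *)
Definition even_sphere_measure
    (rho : {finite_measure set borel_rV -> \bar R}) : Prop :=
  rho (~` sphere) = 0%E /\
  forall B : set borel_rV, measurable B ->
    rho [set x | B (- (x : 'rV[R]_n))] = rho B.

(* For a nonempty compact Z the supremum is a maximum. *)
Definition support_fun Z x : R := sup [set dotp x z | z in Z].

Definition zonoid Z : Prop :=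
  [/\ Z !=set0, compact Z, convex_set Z &
    exists rho : {finite_measure set borel_rV -> \bar R},
      even_sphere_measure rho /\
      forall x, (support_fun Z x)%:E = (\int[rho]_(y in sphere) `|dotp x y|%:E)%E].

Definition affine_hull A : set 'rV[R]_n :=
  [set x | exists k (c : 'I_k -> R) (a : 'I_k -> 'rV[R]_n),
    [/\ forall i, A (a i), \sum_i c i = 1 & x = \sum_i c i *: a i]].

(* A has dimension d when its affine hull is a translate of a d-dimensional
   linear subspace. *)
Definition has_dim A (d : nat) : Prop :=
  exists (p : 'rV[R]_n) (V : {vspace 'rV[R]_n}),
    affine_hull A = [set p + v | v in [set v | v \in V]] /\ \dim V = d.

Definition polar Z : set 'rV[R]_n := [set y | forall x, Z x -> dotp x y <= 1].

End convex_bodies.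

(* Main.v *)
(* Gordon, Meyer and Reisner's argument, with [exp (- h)] in place of the polar
   body. By approximation Z is a zonotope, the sum of the segments [-y_j, y_j],
   with support function h x = \sum_j |<x, y_j>|; put I = \int exp (- h), which
   is n! vol(Z°) by homogeneity. The claim becomes vol(Z) I >= 4^n, proved by
   induction on n from two inequalities.
   (1) Let F_j(t) be the integral of exp (- h) over the hyperplane <x, y_j> = t.
   By Prékopa's theorem F_j is log-concave, and it is even, so that
   F_j(0) \int |t| F_j(t) dt <= (\int F_j)^2 / 2. Since n I = \int h exp (- h) by
   homogeneity, summing over j gives 2 n <= I \sum_j |y_j| / F_j(0).
   (2) Let P_j be the projection along y_j. Adding 2 s |y_j| vol(P_j Z) to the
   volume for each segment stretched by s and letting s tend to 0 gives
   2 \sum_j |y_j| vol(P_j Z) <= n vol(Z).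
   Finally F_j(0) is the integral I of the zonotope P_j Z of dimension n - 1, so
   that vol(P_j Z) F_j(0) >= 4^(n-1). *)
From HB Require Import structures.
Require Import Defs.
From mathcomp Require Import all_boot all_order all_algebra.
From mathcomp Require Import all_classical all_reals all_analysis.
From mathcomp Require Import measurable_realfun ring lra.

Set Implicit Arguments.
Unset Strict Implicit.
Unset Printing Implicit Defensive.

Import Order.TTheory GRing.Theory Num.Theory.
Import numFieldNormedType.Exports.

Local Open Scope classical_set_scope.
Local Open Scope ring_scope.

(** * Product Lebesgue measure on row vectors *)

(** On the hyperplane orthogonal to y_j the j-th term of h vanishes and <x, y_i> = <x, P_j y_i>:
    this is why F_j(0) is the integral of P_j Z and why the induction closes on the same functional.
    The constant comes from S = \sum_j |y_j| / F_j(0): by induction (2) gives 2 4^(n-1) S <= n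
    vol(Z), while (1) reads 2 n <= I S, and multiplying the two eliminates S. The obstacle is
    Euclidean geometry in coordinates. Rotations are avoided by writing y_j = a (1, w) and using
    only shears and the last coordinates. Projecting along y_j onto these coordinates, instead of
    orthogonally, multiplies vol(P_j Z) by sqrt(1 + |w|^2); parametrizing the hyperplane by them
    divides F_j(0) by the same factor. As |y_j| = |a| sqrt(1 + |w|^2), the products |y_j| vol(P_j Z)
    and the quotients |y_j| / F_j(0) keep their values with |a| in place of |y_j|. First coordinates
    must then be nonzero, which a small perturbation of the family ensures. No derivative is taken:
    each limit is an inequality up to a factor (1 + e)^n for all e in ]0, 1]. *)

Section affine_change_R.
Context (R : realType).
Implicit Types (s a : R).
Local Notation mu := (@lebesgue_measure R).

Lemma measurable_affine s a :
  measurable_fun [set: measurableTypeR R]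
    (fun x : measurableTypeR R => s * x + a : measurableTypeR R).
Proof. by apply: measurable_funD => //; exact: mulrl_measurable. Qed.

(** Lebesgue measure is determined by its values on the intervals []u, v]], so it suffices to
    compute the preimage of such an interval. *)
Lemma lebesgue_measure_affine s a (A : set (measurableTypeR R)) : s != 0 ->
  measurable A -> mu A = (`|s|%:E * mu [set x | A (s * x + a)%R])%E.
Proof.
move=> s0 mA.
pose phi (x : measurableTypeR R) : measurableTypeR R := s * x + a.
have mphi : measurable_fun setT phi by exact: measurable_affine.
apply: (@lebesgue_measure_unique R
  (mscale (NngNum (normr_ge0 s)) (pushforward mu phi))) => //.
move=> _ [[u v] _ <-] /=.
rewrite lebesgue_measure_itv/= /mscale/= /pushforward/=.
case: (ltgtP s 0) s0 => // [sneg|spos] _.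
  (* A negative [s] swaps the endpoints, and with them the open and the closed side; the length is
     not affected. *)
  rewrite (_ : _ @^-1` _ = `[(v - a) / s, (u - a) / s[%classic); last first.
    apply/seteqP; split=> x /=; rewrite !in_itv/= /phi.
      rewrite ler_ndivrMr// ltr_ndivlMr// => /andP[ux xv].
      apply/andP; split; lra.
    rewrite ler_ndivrMr// ltr_ndivlMr// => /andP[ux xv].
    apply/andP; split; lra.
  rewrite lebesgue_measure_itv/= !lte_fin ltr_nM2r ?invr_lt0// ltrD2r.
  case: ifPn => uv; last by rewrite mule0.
  rewrite -!EFinD -EFinM ltr0_norm//; congr (_%:E); field.
  by rewrite lt_eqF.
rewrite (_ : _ @^-1` _ = `](u - a) / s, (v - a) / s]%classic); last first.
  apply/seteqP; split=> x /=; rewrite !in_itv/= /phi.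
    rewrite ler_pdivlMr// ltr_pdivrMr// => /andP[ux xv].
    apply/andP; split; lra.
  rewrite ler_pdivlMr// ltr_pdivrMr// => /andP[ux xv].
  apply/andP; split; lra.
rewrite lebesgue_measure_itv/= !lte_fin ltr_pM2r ?invr_gt0// ltrD2r.
case: ifPn => uv; last by rewrite mule0.
rewrite -!EFinD -EFinM gtr0_norm//; congr (_%:E); field.
by rewrite gt_eqF.
Qed.

Lemma integral_affine s a (f : R -> \bar R) : s != 0 ->
  measurable_fun [set: measurableTypeR R] f -> (forall x, 0 <= f x)%E ->
  (\int[mu]_x f (s * x + a)%R = `|s|^-1%:E * \int[mu]_x f x)%E.
Proof.
move=> s0 mf f0.
pose phi (x : measurableTypeR R) : measurableTypeR R := s * x + a.
have mphi : measurable_fun setT phi by exact: measurable_affine.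
have sgt0 : 0 < `|s| by rewrite normr_gt0.
have sV0 : 0 <= `|s|^-1 by rewrite invr_ge0 ltW.
transitivity (\int[pushforward mu phi]_x f x)%E.
  by rewrite (@ge0_integral_pushforward _ _ _ _ _ phi).
rewrite (@eq_measure_integral _ _ _ setT (mscale (NngNum sV0) mu)).
  by rewrite ge0_integral_mscale.
move=> A mA _; change (pushforward mu phi A = `|s|^-1%:E * mu A)%E.
rewrite (@lebesgue_measure_affine s a A)// muleA.
by rewrite -EFinM mulVf ?gt_eqF// mul1e.
Qed.

End affine_change_R.

Section rowcons.
Context (R : realType).

Definition rowcons n (x : R) (v : 'rV[R]_n) : 'rV[R]_n.+1 :=
  \row_i oapp (v ord0) x (unlift ord0 i).

Lemma rowcons0 n x (v : 'rV[R]_n) : rowcons x v ord0 ord0 = x.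
Proof. by rewrite mxE unlift_none. Qed.

Lemma rowconsS n x (v : 'rV[R]_n) i : rowcons x v ord0 (lift ord0 i) = v ord0 i.
Proof. by rewrite mxE liftK. Qed.

Lemma rowcons_surj n (v : 'rV[R]_n.+1) :
  v = rowcons (v ord0 ord0) (\row_i v ord0 (lift ord0 i)).
Proof.
apply/rowP => i; case: (unliftP ord0 i) => [j|] ->.
  by rewrite rowconsS mxE.
by rewrite rowcons0.
Qed.

Lemma rowcons_lin n s x y (u v : 'rV[R]_n) :
  s *: rowcons x u + rowcons y v = rowcons (s * x + y) (s *: u + v).
Proof.
apply/rowP => i; case: (unliftP ord0 i) => [j|] ->; rewrite !mxE ?liftK/= ?unlift_none //=.
by rewrite !mxE.
Qed.

Lemma dotp_rowcons n x y (u v : 'rV[R]_n) :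
  dotp (rowcons x u) (rowcons y v) = x * y + dotp u v.
Proof.
rewrite /dotp big_ord_recl !rowcons0; congr (_ + _).
by apply: eq_bigr => i _; rewrite !rowconsS.
Qed.

Lemma row_tcons n (p : measurableTypeR R * n.-tuple (measurableTypeR R)) :
  \row_i tnth (tcons p) i = rowcons p.1 (\row_i tnth p.2 i).
Proof.
apply/rowP => i; case: (unliftP ord0 i) => [j|] ->.
  by rewrite rowconsS !mxE tnthS.
by rewrite rowcons0 mxE.
Qed.

End rowcons.

Section measurability.
Context (R : realType).

(* Measurability on ['rV_n], which carries no sigma-algebra in the library, is
   understood through its coordinates, for the product sigma-algebra of tuples. *)
Definition mrow n d (T : measurableType d) (f : 'rV[R]_n -> T) :=
  measurable_fun [set: n.-tuple (measurableTypeR R)]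
    (fun t => f (\row_i tnth t i)).

(** Balls for the sup norm are boxes, hence measurable for the product sigma-algebra, and an open
    set is the union of the countably many balls with rational center and radius [1 / (k + 1)] that
    it contains. *)
Lemma open_mrow n (U : set 'rV[R]_n) : open U ->
  measurable [set t : n.-tuple (measurableTypeR R) | U (\row_i tnth t i)].
Proof.
move=> oU.
pose B (p : 'rV[rat]_n * nat) := ball (map_mx (@ratr R) p.1) (p.2.+1%:R^-1 : R).
rewrite (_ : [set _ | _] = \bigcup_p
   [set t | B p `<=` U /\ B p (\row_i tnth t i)]); last first.
  apply/seteqP; split => t /=; last by move=> [p _ [Pp]]; exact: Pp.
  move=> Ut; have /nbhs_ballP[e /= e0 eU] := open_nbhs_nbhs (conj oU Ut).
  have [k [d [dE d0 de]]] : exists k (d : R), [/\ d = k.+1%:R^-1, 0 < d & d < e / 2].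
    have e20 : 0 < e / 2 by lra.
    have [k _ /(_ k (leqnn _)) kP] := near_infty_natSinv_lt (PosNum e20).
    by exists k, (k.+1%:R^-1); split; rewrite ?invr_gt0.
  have /all_sig[q qP] i : {q : rat | `|tnth t i - ratr q| < d}.
    apply: cid.
    have [|q /=] := @rat_in_itvoo R (tnth t i - d) (tnth t i + d); first by lra.
    rewrite in_itv/= => /andP[q1 q2]; exists q.
    by rewrite ltr_distlC; apply/andP; split; lra.
  exists (\row_i q i, k) => //; split => /=; last first.
    rewrite /B /ball/= -dE; split => // i j; rewrite !mxE.
    by rewrite -ball_normE /ball_/= distrC; exact: qP.
  move=> z [_ Bz]; apply: eU; split => // i j; rewrite (ord1 i).
  have := Bz ord0 j; rewrite -dE -!ball_normE /ball_/= !mxE => Bzj.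
  have : `|tnth t j - z ord0 j| <= `|tnth t j - ratr (q j)| + `|ratr (q j) - z ord0 j|.
    by rewrite (le_trans _ (ler_normD _ _))// addrA subrK.
  have := qP j.
  lra.
apply: countable_bigcupT_measurable => // p.
have [BU|nBU] := pselect (B p `<=` U); last first.
  by rewrite (_ : [set _ | _] = set0)//; apply/seteqP; split => t // [].
rewrite (_ : [set _ | _] = \bigcap_(i in [set: 'I_n])
    ((fun t => tnth t i) @^-1` ball (ratr (p.1 ord0 i) : R) (p.2.+1%:R^-1 : R))).
  apply: fin_bigcap_measurable => // i _; rewrite -[X in measurable X]setTI.
  by apply: measurable_tnth => //; exact: measurable_ball.
apply/seteqP; split => t /=.
  by move=> [_ [_ Bt]] i _; have := Bt ord0 i; rewrite !mxE.
move=> Bt; split => //; split; first by rewrite invr_gt0.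
by move=> i j; rewrite (ord1 i) !mxE; exact: Bt.
Qed.

Lemma closed_mrow n (A : set 'rV[R]_n) : closed A ->
  measurable [set t : n.-tuple (measurableTypeR R) | A (\row_i tnth t i)].
Proof.
move=> cA; rewrite -[X in measurable X]setCK; apply: measurableC.
exact: (@open_mrow n (~` A) (closed_openC cA)).
Qed.

Lemma continuous_mrow n (f : 'rV[R]_n -> R) : continuous f ->
  mrow (f : _ -> measurableTypeR R).
Proof.
move=> cf; apply: (measurability _ (RGenOpens.measurableE R)) => //.
move=> _ [_ [a [b ->]] <-]; rewrite setTI.
apply: (@open_mrow n (f @^-1` `]a, b[%classic)).
by apply: open_comp => //; exact: interval_open.
Qed.

Lemma mrow_comp n m d (T : measurableType d) (f : 'rV[R]_m -> T)
    (phi : 'rV[R]_n -> 'rV[R]_m) :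
  continuous phi -> mrow f -> mrow (f \o phi).
Proof.
move=> cphi mf.
pose Phi (t : n.-tuple (measurableTypeR R)) : m.-tuple (measurableTypeR R) :=
  [tuple phi (\row_i tnth t i) ord0 j | j < m].
have mPhi : measurable_fun setT Phi.
  apply/measurable_fun_tnthP => j.
  rewrite (_ : _ \o _ = fun t => phi (\row_i tnth t i) ord0 j); last first.
    by apply/funext => t /=; rewrite tnth_mktuple.
  apply: (@continuous_mrow n (fun v => phi v ord0 j)) => v.
  apply: (@continuous_comp _ _ _ phi (fun w : 'rV[R]_m => w ord0 j)).
    exact: cphi.
  exact: coord_continuous.
have := measurableT_comp mf mPhi.
rewrite /mrow; congr (measurable_fun _ _); apply/funext => t /=.
by congr f; apply/rowP => j; rewrite mxE tnth_mktuple.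
Qed.

Lemma continuous_row n (T : topologicalType) (phi : T -> 'rV[R]_n) :
  (forall i, continuous (fun t => phi t ord0 i)) -> continuous phi.
Proof.
move=> cphi t; apply/cvg_ballP => e e0.
have : \forall x \near t, forall j, ball (phi t ord0 j) e (phi x ord0 j).
  by apply: filter_forall => j; have /cvg_ballP := cphi j t; exact.
by apply: filterS => x Hx; split => // i j; rewrite (ord1 i).
Qed.

End measurability.

Section tuple_integral.
Context (R : realType).
Local Notation mu := (@lebesgue_measure R).

Definition Lint n (f : 'rV[R]_n -> \bar R) : \bar R :=
  (\int[lebesgue_tuple R n]_t f (\row_i tnth t i))%E.

Lemma mrow_cons n d (T : measurableType d) (f : 'rV[R]_n.+1 -> T) : mrow f ->
  measurable_fun [set: measurableTypeR R * n.-tuple (measurableTypeR R)]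
    (fun p => f (rowcons p.1 (\row_i tnth p.2 i))).
Proof.
move=> mf; have := measurableT_comp mf (@measurable_tcons R n).
by congr (measurable_fun _ _); apply/funext => p /=; rewrite -row_tcons.
Qed.

Lemma mrow_slice n d (T : measurableType d) (f : 'rV[R]_n.+1 -> T) x :
  mrow f -> mrow (fun v => f (rowcons x v)).
Proof.
by move=> mf; have := measurableT_comp (mrow_cons mf) (measurable_pair1 x).
Qed.

Lemma mrow_slice1 n d (T : measurableType d) (f : 'rV[R]_n.+1 -> T) v :
  mrow f -> measurable_fun [set: measurableTypeR R] (fun x => f (rowcons x v)).
Proof.
move=> /mrow_cons mf.
have /= := measurableT_comp mf
  (measurable_pair2 [tuple v ord0 i | i < n]).
congr (measurable_fun _ _); apply/funext => x /=; congr (f (rowcons _ _)).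
by apply/rowP => i; rewrite mxE tnth_mktuple.
Qed.

Lemma Lint0 (f : 'rV[R]_0 -> \bar R) : Lint f = f 0.
Proof.
rewrite /Lint/= (_ : (fun t => _) = cst (f 0)); last first.
  by apply/funext => t; congr f; apply/rowP => -[].
by rewrite integral_dirac// diracT mul1e.
Qed.

Lemma Lint_ge0 n (f : 'rV[R]_n -> \bar R) :
  (forall v, 0 <= f v)%E -> (0 <= Lint f)%E.
Proof. by move=> f0; apply: integral_ge0 => t _; exact: f0. Qed.

Lemma ge0_le_Lint n (f g : 'rV[R]_n -> \bar R) : (forall v, 0 <= f v)%E ->
  mrow f -> mrow g -> (forall v, f v <= g v)%E -> (Lint f <= Lint g)%E.
Proof.
move=> f0 mf mg fg; by apply: ge0_le_integral.
Qed.

Lemma eq_Lint n (f g : 'rV[R]_n -> \bar R) : f =1 g -> Lint f = Lint g.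
Proof. by move=> fg; apply: eq_integral => t _; exact: fg. Qed.

Lemma LintZl n (k : R) (f : 'rV[R]_n -> \bar R) : mrow f ->
  (forall v, 0 <= f v)%E -> 0 <= k ->
  (Lint (fun v => k%:E * f v) = k%:E * Lint f)%E.
Proof.
move=> mf f0 k0; by rewrite /Lint ge0_integralZl_EFin.
Qed.

Lemma LintD n (f g : 'rV[R]_n -> \bar R) : mrow f -> mrow g ->
  (forall v, 0 <= f v)%E -> (forall v, 0 <= g v)%E ->
  (Lint (fun v => f v + g v) = Lint f + Lint g)%E.
Proof. by move=> mf mg f0 g0; rewrite /Lint ge0_integralD. Qed.

Section tonelli.
Variables (n : nat) (f : 'rV[R]_n.+1 -> \bar R).
Hypotheses (mf : mrow f) (f0 : forall v, (0 <= f v)%E).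
Let F (p : measurableTypeR R * n.-tuple (measurableTypeR R)) :=
  f (rowcons p.1 (\row_i tnth p.2 i)).
Let mF : measurable_fun setT F. Proof. exact: mrow_cons. Qed.

Let LintF : Lint f = (\int[mu \x lebesgue_tuple R n]_p F p)%E.
Proof.
rewrite /Lint (@eq_measure_integral _ _ _ setT
  (pushforward (mu \x lebesgue_tuple R n)%E (@tcons R n)))//.
  exact: measurable_tcons.
move=> mt; rewrite ge0_integral_pushforward//.
rewrite preimage_setT; apply: eq_integral => p _ /=.
by rewrite row_tcons.
Qed.

Lemma Lint_cons1 : Lint f = (\int[mu]_x Lint (fun v => f (rowcons x v)))%E.
Proof. by rewrite LintF fubini_tonelli1// => p; exact: f0. Qed.

Lemma Lint_cons2 : Lint f = Lint (fun v => \int[mu]_x f (rowcons x v))%E.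
Proof. by rewrite LintF fubini_tonelli2// => p; exact: f0. Qed.

Lemma measurable_Lint_slice :
  measurable_fun [set: measurableTypeR R] (fun x => Lint (fun v => f (rowcons x v))).
Proof.
by have := @measurable_fun_fubini_tonelli_F _ _ _ _ _ (lebesgue_tuple R n) F mF
  (fun p => f0 _).
Qed.

Lemma mrow_integral_slice : mrow (fun v => \int[mu]_x f (rowcons x v))%E.
Proof.
by have := @measurable_fun_fubini_tonelli_G _ _ _ _ _ mu F mF (fun p => f0 _).
Qed.

End tonelli.

Lemma continuous_affine n s (a : 'rV[R]_n) : continuous (fun v : 'rV[R]_n => s *: v + a).
Proof.
move=> v; apply: continuousD; last exact: cst_continuous.
exact: scaler_continuous.
Qed.

(** One scalar substitution per coordinate, by induction on [n]. Together with shears, homotheties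
    and translations are the only changes of variables in the proof, so no determinant formula is
    involved. *)
Lemma Lint_affine n s (a : 'rV[R]_n) (f : 'rV[R]_n -> \bar R) : s != 0 ->
  mrow f -> (forall v, 0 <= f v)%E ->
  (Lint (fun v => f (s *: v + a)%R) = (`|s| ^- n)%:E * Lint f)%E.
Proof.
move=> s0; elim: n a f => [|n IH] a f mf f0.
  rewrite !Lint0 expr0 invr1 mul1e; congr f; apply/rowP => -[]//.
have maf : mrow (fun v => f (s *: v + a)).
  by apply: mrow_comp => //; exact: continuous_affine.
rewrite Lint_cons1// [in RHS]Lint_cons1//.
under eq_integral => x _.
  rewrite (eq_Lint (g := fun v => f (rowcons (s * x + a ord0 ord0)
     (s *: v + \row_i a ord0 (lift ord0 i))))); last first.
    by move=> v; rewrite -rowcons_lin -rowcons_surj.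
  rewrite (IH _ (fun v => f (rowcons (s * x + a ord0 ord0) v)))//; last exact: mrow_slice.
  over.
have mLa : measurable_fun [set: measurableTypeR R]
    (fun x => Lint (fun v => f (rowcons (s * x + a ord0 ord0) v))).
  exact: (measurableT_comp (measurable_Lint_slice mf f0)
    (measurable_affine s (a ord0 ord0))).
have L0 x : [set: measurableTypeR R] x ->
    (0 <= Lint (fun v => f (rowcons (s * x + a ord0 ord0) v)))%E.
  by move=> _; exact: Lint_ge0.
have sn0 : 0 <= `|s| ^- n by rewrite invr_ge0 exprn_ge0.
rewrite /= (ge0_integralZl_EFin _ measurableT L0 mLa sn0).
rewrite (integral_affine (a ord0 ord0) s0 (measurable_Lint_slice mf f0)); last first.
  by move=> x; exact: Lint_ge0.
by rewrite muleA -EFinM -invfM -exprSr.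
Qed.

Definition mset n (A : set 'rV[R]_n) :=
  measurable [set t : n.-tuple (measurableTypeR R) | A (\row_i tnth t i)].

Lemma mrow_indic n (A : set 'rV[R]_n) : mset A -> mrow (EFin \o (\1_A : _ -> R)).
Proof.
move=> mA; apply/measurable_EFinP.
have := @measurable_indic _ _ R setT _ mA.
by congr (measurable_fun _ _); apply/funext => t /=; rewrite !indicE.
Qed.

Lemma vol_Lint n (A : set 'rV[R]_n) : mset A -> vol A = Lint (EFin \o \1_A).
Proof.
move=> mA; rewrite /vol -[X in lebesgue_tuple R n X]setIT -integral_indic//.
Qed.

Lemma vol_ge0 n (A : set 'rV[R]_n) : (0 <= vol A)%E.
Proof. by rewrite /vol measure_ge0. Qed.

Lemma vol_le n (A B : set 'rV[R]_n) : mset A -> mset B -> A `<=` B ->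
  (vol A <= vol B)%E.
Proof. by move=> mA mB AB; apply: le_measure; rewrite ?inE// => t /=; exact: AB. Qed.

Lemma mset_affine n s (a : 'rV[R]_n) (A : set 'rV[R]_n) : mset A ->
  mset [set v | A (s *: v + a)].
Proof.
move=> mA; have := mrow_comp (continuous_affine (s := s) (a := a)) (mrow_indic mA).
move=> /measurable_EFinP mI; apply/(@measurable_indicP _ _ R).
by move: mI; congr (measurable_fun _ _); apply/funext => t /=; rewrite !indicE.
Qed.

Lemma vol_affine n s (a : 'rV[R]_n) (A : set 'rV[R]_n) : s != 0 -> mset A ->
  (vol [set v | A (s *: v + a)%R] = (`|s| ^- n)%:E * vol A)%E.
Proof.
move=> s0 mA; rewrite !vol_Lint//; last exact: mset_affine.
rewrite -(@Lint_affine _ _ a)//.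
- exact: mrow_indic.
- by move=> v; rewrite /= lee_fin.
Qed.

End tuple_integral.

(** * Log-concavity of marginals *)

Section prekopa_R.
Context (R : realType).
Local Notation mu := (@lebesgue_measure R).
Implicit Types (f g m : R -> R).

(** Such a set lies in the segment [[sup I - d, sup I]]. *)
Lemma lebesgue_measure_le_diam (I : set R) (d : R) :
  I !=set0 -> measurable I ->
  (forall a b, I a -> I b -> b - a <= d) -> (mu I <= d%:E)%E.
Proof.
move=> [x0 Ix0] mI Id.
have d0 : 0 <= d by have := Id _ _ Ix0 Ix0; rewrite subrr.
have ubI : has_sup I.
  split; first by exists x0.
  by exists (x0 + d) => x Ix; have := Id _ _ Ix0 Ix; lra.
have -> : d%:E = mu `[sup I - d, sup I]%classic.
  rewrite lebesgue_measure_itv/= lte_fin.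
  case: ifPn => [_|]; first by rewrite -EFinB; congr (_%:E); lra.
  by rewrite -leNgt => H; congr (_%:E); lra.
apply: le_measure; rewrite ?inE//.
move=> x Ix /=; rewrite in_itv/= (ub_le_sup _ Ix) ?andbT; last by case: ubI.
rewrite lerBlDr; apply: ge_sup; first by exists x0.
by move=> y Iy; have := Id _ _ Ix Iy; lra.
Qed.

(** Since [L] is an interval, it contains the whole segment between two combinations of points of
    [I] and [J]. Hence [(1 - l)] times the diameter of [I] plus [l] times that of [J] is at most the
    measure of [L], and diameters bound measures. *)
Lemma brunn_minkowski_itv (I J L : set R) (l : R) : 0 < l < 1 ->
  I !=set0 -> J !=set0 -> measurable I -> measurable J -> measurable L ->
  is_interval L -> (forall a b, I a -> J b -> L ((1 - l) * a + l * b)) ->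
  ((1 - l)%:E * mu I + l%:E * mu J <= mu L)%E.
Proof.
move=> /andP[l0 l1] I0 J0 mI mJ mL iL IJL.
have [->|] := eqVneq (mu L) +oo%E; first by rewrite leey.
move=> muL; have : mu L \is a fin_num.
  by rewrite ge0_fin_numE// ltey.
move=> /fineK <-; set d := fine (mu L) in muL *.
have dE : mu L = d%:E by rewrite fineK// ge0_fin_numE// ltey.
have H a a' b b' : I a -> I a' -> J b -> J b' ->
    (1 - l) * (a' - a) + l * (b' - b) <= d.
  move=> Ia Ia' Jb Jb'; rewrite -lee_fin -dE.
  have sub : `[(1 - l) * a + l * b, (1 - l) * a' + l * b']%classic `<=` L.
    by move=> z /=; rewrite in_itv/= => zz; apply: (iL _ _ _ _ z zz); exact: IJL.
  apply: (@le_trans _ _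
    (mu `[(1 - l) * a + l * b, (1 - l) * a' + l * b']%classic)); last first.
    by apply: le_measure; rewrite ?inE.
  rewrite lebesgue_measure_itv/= lte_fin; case: ifPn => [_|].
    by rewrite -EFinB lee_fin; lra.
  by rewrite -leNgt lee_fin; lra.
have [b Jb] := J0; have [a Ia] := I0.
have HI b1 b2 : J b1 -> J b2 -> (mu I <= ((d - l * (b2 - b1)) / (1 - l))%:E)%E.
  move=> J1 J2; apply: lebesgue_measure_le_diam => // a1 a2 I1 I2.
  by rewrite ler_pdivlMr; [have := H _ _ _ _ I1 I2 J1 J2; lra|lra].
have fI : mu I \is a fin_num.
  by rewrite ge0_fin_numE// (le_lt_trans (HI _ _ Jb Jb))// ltry.
set i := fine (mu I); have iE : mu I = i%:E by rewrite fineK.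
have HJ : (mu J <= ((d - (1 - l) * i) / l)%:E)%E.
  apply: lebesgue_measure_le_diam => // b1 b2 J1 J2.
  have := HI _ _ J1 J2; rewrite iE lee_fin !ler_pdivlMr; lra.
have fJ : mu J \is a fin_num by rewrite ge0_fin_numE// (le_lt_trans HJ)// ltry.
move: HJ; rewrite iE -(fineK fJ) -!EFinM -EFinD !lee_fin ler_pdivlMr//; lra.
Qed.

(** The cut at [0 < r < 1] keeps the levels at which a function with supremum [C] has a nonempty
    superlevel set, as Brunn-Minkowski requires. *)
Definition level m (C r : R) : set R := [set x | (0 < r < 1) && (C * r < m x)].

Lemma measurable_level m (C r : R) : measurable_fun [set: measurableTypeR R] m ->
  measurable (level m C r : set (measurableTypeR R)).
Proof.
move=> mm; have mb : measurable_fun setT (fun x : measurableTypeR R =>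
    (0 < r < 1) && (C * r < m x)).
  by apply: measurable_and => //; exact: measurable_fun_ltr.
by have := mb measurableT [set true] I; rewrite setTI.
Qed.

(** The truncation at 1 reflects the cut of the levels. It changes nothing when [C] is the supremum
    of [m]; otherwise it can only decrease the integral of [m / C]. *)
Lemma layer_cake_min m (C : R) : 0 < C -> (forall x, 0 < m x) ->
  measurable_fun [set: measurableTypeR R] m ->
  measurable_fun [set: measurableTypeR R] (fun r => mu (level m C r)) /\
  (\int[mu]_x (Num.min 1 (m x / C))%:E = \int[mu]_r mu (level m C r))%E.
Proof.
move=> C0 m0 mm.
pose E := [set p : measurableTypeR R * measurableTypeR R |
  (0 < p.2 < 1) && (C * p.2 < m p.1)].
have mE : measurable E.
  have mb : measurable_fun setT (fun p : measurableTypeR R * measurableTypeR R =>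
      (0 < p.2 < 1) && (C * p.2 < m p.1)).
    apply: measurable_and.
      by apply: measurable_and; exact: measurable_fun_ltr.
    apply: measurable_fun_ltr; first exact: measurable_funM.
    exact: measurableT_comp.
  by have := mb measurableT [set true] I; rewrite setTI.
pose F (p : measurableTypeR R * measurableTypeR R) : \bar R := (\1_E p)%:E.
have mF : measurable_fun setT F by exact/measurable_EFinP/measurable_indic.
have F0 p : (0 <= F p)%E by rewrite /F lee_fin.
have FG : (fun r => \int[mu]_x F (x, r))%E = (fun r => mu (level m C r)).
  apply/funext => r; rewrite (_ : (fun x => _) = EFin \o \1_(level m C r)).
    by rewrite integral_indic ?setIT//; exact: measurable_level.
  by apply/funext => x /=; rewrite /F !indicE.
split.
  by rewrite -FG; exact: (measurable_fun_fubini_tonelli_G F mF F0).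
rewrite -FG -(fubini_tonelli F mF F0); apply: eq_integral => x _.
rewrite (_ : (fun r => _) = EFin \o \1_(`]0, Num.min 1 (m x / C)[)); last first.
  apply/funext => r /=; rewrite /F !indicE; congr ((nat_of_bool _)%:R%:E); apply/idP/idP.
    rewrite !inE /E/= in_itv/= => /andP[/andP[-> r1] rm].
    by rewrite lt_min r1 ltr_pdivlMr// mulrC.
  rewrite !inE /E/= in_itv/= => /andP[->].
  by rewrite lt_min ltr_pdivlMr// mulrC => /andP[-> ->].
rewrite integral_indic// setIT.
etransitivity; last by apply/esym; exact: lebesgue_measure_itv.
have min0 : 0 < Num.min 1 (m x / C) by rewrite lt_min ltr01 divr_gt0.
by rewrite /= lte_fin min0 oppr0 adde0.
Qed.

(** Meaningful for positive functions, the only ones it is applied to: [ln] is 0 at nonpositive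
    arguments. *)
Definition logconcave (V : lmodType R) (f : V -> R) := forall x y l, 0 < l < 1 ->
  (1 - l) * ln (f x) + l * ln (f y) <= ln (f ((1 - l) *: x + l *: y)).

Lemma ln_concave (a b l : R) : 0 < l < 1 -> 0 < a -> 0 < b ->
  (1 - l) * ln a + l * ln b <= ln ((1 - l) * a + l * b).
Proof.
move=> /andP[l0 l1] a0 b0.
have l01 : 0 <= l <= 1 by rewrite !ltW.
have := @concave_ln R (Itv01 (ltW l0) (ltW l1)) b a b0 a0.
by rewrite !convRE/= addrC [l * b + _]addrC.
Qed.

Lemma level_neq0 f (A r : R) : has_sup (range f) -> (forall x, 0 < f x) ->
  sup (range f) = A -> 0 < r < 1 -> level f A r !=set0.
Proof.
move=> sf f0 fA /andP[r0 r1].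
have A0 : 0 < A by rewrite -fA (lt_le_trans (f0 0))// ub_le_sup//; case: sf.
have [|_ [x _ <-] H] := @sup_adherent _ _ (A * (1 - r)) _ sf.
  by rewrite mulr_gt0// subr_gt0.
by exists x; rewrite /level/= r0 r1/=; move: H; rewrite fA mulrBr mulr1; lra.
Qed.

(* Prékopa-Leindler: normalizing the suprema to 1, the superlevel sets satisfy
   the one-dimensional Brunn-Minkowski inequality, and the integrals are
   recovered from them by the layer-cake formula. *)
Lemma prekopa_R f g m (l F G M : R) : 0 < l < 1 ->
  (forall x, 0 < f x) -> (forall x, 0 < g x) -> (forall x, 0 < m x) ->
  measurable_fun [set: measurableTypeR R] f ->
  measurable_fun [set: measurableTypeR R] g ->
  measurable_fun [set: measurableTypeR R] m ->
  has_ubound (range f) -> has_ubound (range g) -> @logconcave R^o m ->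
  (forall a b, (1 - l) * ln (f a) + l * ln (g b) <= ln (m ((1 - l) * a + l * b))) ->
  (\int[mu]_x (f x)%:E = F%:E)%E -> (\int[mu]_x (g x)%:E = G%:E)%E ->
  (\int[mu]_x (m x)%:E = M%:E)%E ->
  0 < F -> 0 < G ->
  (1 - l) * ln F + l * ln G <= ln M.
Proof.
move=> l01 f0 g0 m0 mf mg mm ubf ubg lcm fgm FE GE ME F0 G0.
have /andP[l0 l1] := l01.
have sf : has_sup (range f) by split => //; exists (f 0); exists 0.
have sg : has_sup (range g) by split => //; exists (g 0); exists 0.
pose A := sup (range f); pose B := sup (range g).
have A0 : 0 < A by rewrite (lt_le_trans (f0 0))// ub_le_sup//; exists 0.
have B0 : 0 < B by rewrite (lt_le_trans (g0 0))// ub_le_sup//; exists 0.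
(* The weighted geometric mean of the two suprema: [A * r < f a] and [B * r < g b] then force
   [C * r < m] at the combined point. *)
pose C := expR ((1 - l) * ln A + l * ln B).
have C0 : 0 < C by exact: expR_gt0.
have [mlf Ef] := layer_cake_min A0 f0 mf.
have [mlg Eg] := layer_cake_min B0 g0 mg.
have [mlm Em] := layer_cake_min C0 m0 mm.
(* Log-concavity of [m] serves here only: it makes the superlevel sets of [m] intervals. *)
have itvm r : is_interval (level m C r).
  move=> x y /andP[r01 mx] /andP[_ my] z /andP[xz zy]; rewrite /level/= r01/=.
  have /andP[r0 _] := r01.
  move: xz zy; rewrite le_eqVlt => /predU1P[<-//|xz].
  rewrite le_eqVlt => /predU1P[->//|zy].
  pose t := (z - x) / (y - x).
  have yx : 0 < y - x by lra.
  have t01 : 0 < t < 1.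
    apply/andP; split; first by rewrite divr_gt0// subr_gt0.
    by rewrite /t ltr_pdivrMr// mul1r; lra.
  have -> : z = (1 - t) *: (x : R^o) + t *: (y : R^o).
    by rewrite /GRing.scale/= /t; field; rewrite gt_eqF.
  have Cr : 0 < C * r by rewrite mulr_gt0.
  rewrite -ltr_ln ?posrE//; apply: lt_le_trans (lcm x y t t01).
  move: mx my; rewrite -ltr_ln ?posrE// -(@ltr_ln _ (C * r) (m y)) ?posrE//.
  move: t01 => /andP[t0 t1]; nra.
have BM r : ((1 - l)%:E * mu (level f A r) + l%:E * mu (level g B r) <=
             mu (level m C r))%E.
  have [r01|r01] := boolP (0 < r < 1); last first.
    have E0 h c : level h c r = set0.
      by apply/seteqP; split => // x; rewrite /level/= (negbTE r01).
    by rewrite !E0 !measure0 !mule0 adde0.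
  apply: brunn_minkowski_itv => //.
  - exact: level_neq0.
  - exact: level_neq0.
  - exact: measurable_level.
  - exact: measurable_level.
  - exact: measurable_level.
  move=> a b; rewrite /level/= r01/= => fa gb.
  have /andP[r0 r1] := r01.
  rewrite -ltr_ln ?posrE ?mulr_gt0//.
  apply: lt_le_trans (fgm a b).
  rewrite lnM ?posrE// /C expRK.
  move: fa gb; rewrite -ltr_ln ?posrE ?mulr_gt0// -(@ltr_ln _ (B * r)) ?posrE ?mulr_gt0//.
  rewrite !lnM ?posrE//; nra.
have minfA x : Num.min 1 (f x / A) = f x / A.
  by apply/min_idPr; rewrite ler_pdivrMr// mul1r ub_le_sup//; exists x.
have mingB x : Num.min 1 (g x / B) = g x / B.
  by apply/min_idPr; rewrite ler_pdivrMr// mul1r ub_le_sup//; exists x.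
have FA : (\int[mu]_r mu (level f A r) = (F / A)%:E)%E.
  rewrite -Ef; under eq_integral do rewrite minfA mulrC EFinM.
  rewrite ge0_integralZl_EFin ?invr_ge0 ?ltW//; last 2 first.
  - by move=> x _; rewrite lee_fin ltW.
  - exact/measurable_EFinP.
  by rewrite FE -EFinM mulrC.
have GB : (\int[mu]_r mu (level g B r) = (G / B)%:E)%E.
  rewrite -Eg; under eq_integral do rewrite mingB mulrC EFinM.
  rewrite ge0_integralZl_EFin ?invr_ge0 ?ltW//; last 2 first.
  - by move=> x _; rewrite lee_fin ltW.
  - exact/measurable_EFinP.
  by rewrite GE -EFinM mulrC.
have MC : (\int[mu]_r mu (level m C r) <= (M / C)%:E)%E.
  rewrite -Em mulrC EFinM -ME -ge0_integralZl_EFin ?invr_ge0 ?(ltW C0)//; last 2 first.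
  - by move=> x _; rewrite lee_fin ltW.
  - exact/measurable_EFinP.
  apply: ge0_le_integral => //.
  - move=> x _; rewrite lee_fin le_min ler01/= divr_ge0 ?ltW//.
  - apply/measurable_EFinP; apply: measurable_minr => //.
    exact: measurable_funM.
  - apply/measurable_EFinP; exact: measurable_funM.
  - by move=> x _; rewrite -EFinM lee_fin ge_min mulrC lexx orbT.
have key : (1 - l) * (F / A) + l * (G / B) <= M / C.
  rewrite -lee_fin; apply: le_trans MC.
  rewrite EFinD !EFinM -!EFinM (EFinM (1 - l)) (EFinM l) -FA -GB.
  rewrite -!ge0_integralZl_EFin//; [|lra|lra].
  rewrite -ge0_integralD//; last 4 first.
  - by move=> x _; rewrite mule_ge0// lee_fin; lra.
  - exact: measurable_funeM.
  - by move=> x _; rewrite mule_ge0// lee_fin; lra.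
  - exact: measurable_funeM.
  apply: ge0_le_integral => //.
  - by move=> x _; rewrite adde_ge0// mule_ge0// lee_fin; lra.
  - by apply: emeasurable_funD; exact: measurable_funeM.
have M0 : 0 < M.
  have : 0 < (1 - l) * (F / A) + l * (G / B).
    by rewrite addr_gt0// mulr_gt0// ?divr_gt0//; lra.
  by move=> /lt_le_trans/(_ key); rewrite pmulr_lgt0// invr_gt0.
(* The arithmetic mean in [key] dominates the geometric mean, and in logarithmic form [A], [B] and
   [C] cancel by the choice of [C]. *)
have := ln_concave l01 (divr_gt0 F0 A0) (divr_gt0 G0 B0).
move=> /le_trans; move: key; rewrite -ler_ln ?posrE; last 2 first.
- by rewrite addr_gt0// mulr_gt0// ?divr_gt0//; lra.
- exact: divr_gt0.
move=> key /(_ _ key); rewrite !ln_div ?posrE// /C expRK; nra.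
Qed.

End prekopa_R.

Section positivity.
Context (R : realType).
Local Notation mu := (@lebesgue_measure R).

Lemma integral_gt0 (f : R -> \bar R) :
  measurable_fun [set: measurableTypeR R] f -> (forall x, 0 < f x)%E ->
  (0 < \int[mu]_x f x)%E.
Proof.
move=> mf f0; rewrite lt0e integral_ge0 ?andbT; last by move=> x _; exact: ltW.
apply/eqP => If; have : (\int[mu]_x `|f x| = 0)%E.
  by rewrite -If; apply: eq_integral => x _; rewrite gee0_abs// ltW.
move/(ae_eq_integral_abs mu measurableT mf) => [N [mN N0]].
have -> : ~` [set x | [set: R] x -> f x = 0%E] = setT.
  by apply/seteqP; split => // x _ /= /(_ I) fx; have := f0 x; rewrite fx ltxx.
rewrite subTset => NT; move: N0; rewrite NT.
rewrite -set_itvNyy => H.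
have := lebesgue_measure_itv (`]-oo, +oo[ : interval R).
by move=> /=; rewrite -[X in X = _ -> _]/(mu _) H.
Qed.

Lemma Lint_gt0 n (f : 'rV[R]_n -> \bar R) : mrow f -> (forall v, 0 < f v)%E ->
  (0 < Lint f)%E.
Proof.
elim: n f => [|n IH] f mf f0; first by rewrite Lint0.
have f0' v : (0 <= f v)%E by exact: ltW.
rewrite Lint_cons1//; apply: integral_gt0; first exact: measurable_Lint_slice.
by move=> x; apply: IH => //; exact: mrow_slice.
Qed.

(** With [p] the density of the exponential law of parameter [c], the integrand is at most
    [(p x + p (- x)) / c], and each of the two terms has integral [1 / c]. *)
Lemma integral_expR_abs (c : R) : 0 < c ->
  (\int[mu]_x (expR (- (c * `|x|)))%:E <= (2 / c)%:E)%E.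
Proof.
move=> c0.
pose p := exponential_pdf c.
have mp : measurable_fun [set: measurableTypeR R] p by exact: measurable_exponential_pdf.
have p0 x : 0 <= p x by rewrite exponential_pdf_ge0// ltW.
have mpN : measurable_fun [set: measurableTypeR R] (fun x => p (- 1 * x + 0)).
  exact: (measurableT_comp mp (measurable_affine (-1) 0)).
have Ip : (\int[mu]_x (p x)%:E = 1)%E by exact: integral_exponential_pdf.
have IpN : (\int[mu]_x (p (-1 * x + 0)%R)%:E = 1)%E.
  rewrite (@integral_affine R (-1) 0 (EFin \o p)) ?oppr_eq0 ?oner_eq0//.
  - by rewrite normrN normr1 invr1 mul1e.
  - exact/measurable_EFinP.
have mep : measurable_fun [set: measurableTypeR R] (fun x => (p x)%:E).
  exact/measurable_EFinP.
have mepN : measurable_fun [set: measurableTypeR R] (fun x => (p (-1 * x + 0))%:E).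
  exact/measurable_EFinP.
have -> : ((2 / c)%:E = \int[mu]_x (c^-1%:E * ((p x)%:E + (p (-1 * x + 0)%R)%:E)))%E.
  rewrite ge0_integralZl_EFin ?invr_ge0 ?(ltW c0)//.
  - rewrite ge0_integralD//; try by move=> x _; rewrite lee_fin.
    rewrite Ip IpN -EFinD -EFinM; congr (_%:E); field.
    by rewrite gt_eqF.
  - by move=> x _; rewrite adde_ge0// lee_fin.
  - exact: emeasurable_funD.
apply: ge0_le_integral => //.
- apply/measurable_EFinP; apply: measurableT_comp => //.
  apply: measurable_funN; apply: measurable_funM => //.
- apply: measurable_funeM.
  exact: emeasurable_funD.
move=> x _; rewrite -EFinD -EFinM lee_fin ler_pdivlMl//.
rewrite mulN1r addr0.
case: (leP 0 x) => x0.
  apply: (@le_trans _ _ (p x)); last by rewrite lerDl.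
  by rewrite /p exponential_pdfE// mulNr ger0_norm.
apply: (@le_trans _ _ (p (- x))); last by rewrite lerDr.
by rewrite /p exponential_pdfE ?oppr_ge0 ?(ltW x0)// mulNr ltr0_norm.
Qed.

(** The l1 norm is chosen because its exponential is a product over the coordinates; it serves as
    the dominating function everywhere below. *)
Definition expl1 n (c : R) (v : 'rV[R]_n) := expR (- (c * \sum_i `|v ord0 i|)).

Lemma mrow_EFin n (f : 'rV[R]_n -> R) : mrow (f : _ -> measurableTypeR R) ->
  mrow (EFin \o f).
Proof. by move=> mf; have /measurable_EFinP := mf. Qed.

Lemma measurable_expl1 n c : mrow (@expl1 n c).
Proof.
apply: measurableT_comp => //; apply: measurable_funN.
apply: measurable_funM => //; apply: measurable_sum => i.
apply: measurableT_comp => //.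
by under eq_fun do rewrite mxE; exact: measurable_tnth.
Qed.

Lemma expl1_cons n c x (v : 'rV[R]_n) :
  expl1 c (rowcons x v) = expR (- (c * `|x|)) * expl1 c v.
Proof.
rewrite /expl1 big_ord_recl rowcons0 mulrDr opprD expRD; congr (_ * expR (- (_ * _))).
by apply: eq_bigr => i _; rewrite rowconsS.
Qed.

Lemma Lint_expl1 n (c : R) : 0 < c ->
  (Lint (EFin \o @expl1 n c) <= ((2 / c) ^+ n)%:E)%E.
Proof.
move=> c0; elim: n => [|n IH].
  by rewrite Lint0/= lee_fin expr0 /expl1 big_ord0 mulr0 oppr0 expR0.
have me m : mrow (EFin \o @expl1 m c) by apply: mrow_EFin; exact: measurable_expl1.
have e0 m v : (0 <= (EFin \o @expl1 m c) v)%E by rewrite lee_fin expR_ge0.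
rewrite Lint_cons1//.
under eq_integral => x _.
  rewrite (eq_Lint (g := fun v =>
    (expR (- (c * `|x|)))%:E * (EFin \o @expl1 n c) v)%E); last first.
    by move=> v; rewrite /= expl1_cons EFinM.
  rewrite LintZl ?expR_ge0// muleC.
  over.
have mx : measurable_fun [set: measurableTypeR R] (fun x => (expR (- (c * `|x|)))%:E).
  apply/measurable_EFinP; apply: measurableT_comp => //.
  by apply: measurable_funN; apply: measurable_funM.
rewrite /= ge0_integralZl//; last exact: Lint_ge0.
rewrite exprSr EFinM; apply: lee_pmul => //.
- exact: Lint_ge0.
- by apply: integral_ge0 => x _; rewrite lee_fin expR_ge0.
- exact: integral_expR_abs.
Qed.

End positivity.

Section prekopa.
Context (R : realType).
Local Notation mu := (@lebesgue_measure R).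

(** A class stable under slicing. Positivity makes [ln] meaningful, and exponential decay makes
    integrals finite and slice integrals bounded, as the one-dimensional case demands. *)
Definition lc_decay n (f : 'rV[R]_n -> R) := [/\ forall v, 0 < f v, logconcave f,
  mrow (f : _ -> measurableTypeR R) &
  exists C c, 0 < c /\ forall v, f v <= C * expl1 c v].

(** As [fine] sends an infinite integral to 0, this value is informative only once finiteness is
    known, for instance from [RLint_decay]. *)
Definition RLint n (f : 'rV[R]_n -> R) : R := fine (Lint (EFin \o f)).

Lemma RLint_decay n (f : 'rV[R]_n -> R) C c : 0 < c -> (forall v, 0 < f v) ->
  mrow (f : _ -> measurableTypeR R) -> (forall v, f v <= C * expl1 c v) ->
  Lint (EFin \o f) = (RLint f)%:E /\ 0 < RLint f <= C * (2 / c) ^+ n.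
Proof.
move=> c0 f0 mf fC.
have C0 : 0 <= C.
  have := lt_le_trans (f0 0) (fC 0); rewrite pmulr_lgt0 ?expR_gt0//; exact: ltW.
have Lgt0 : (0 < Lint (EFin \o f))%E.
  by apply: Lint_gt0 => //; exact: mrow_EFin.
have Lle : (Lint (EFin \o f) <= (C * (2 / c) ^+ n)%:E)%E.
  apply: (@le_trans _ _ (Lint (fun v => C%:E * (EFin \o @expl1 R n c) v)%E)).
    apply: ge0_le_Lint => //.
    - by move=> v; rewrite lee_fin ltW.
    - exact: mrow_EFin.
    - by apply: measurable_funeM; apply: mrow_EFin; exact: measurable_expl1.
  have me : mrow (EFin \o @expl1 R n c) by apply: mrow_EFin; exact: measurable_expl1.
  have e0 v : (0 <= (EFin \o @expl1 R n c) v)%E by rewrite lee_fin expR_ge0.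
  rewrite (LintZl me e0 C0).
  by rewrite EFinM lee_wpmul2l ?lee_fin//; exact: Lint_expl1.
have fin : Lint (EFin \o f) \is a fin_num.
  by rewrite ge0_fin_numE ?(ltW Lgt0)// (le_lt_trans Lle)// ltry.
have E : Lint (EFin \o f) = (RLint f)%:E by rewrite fineK.
by rewrite -!lee_fin -!lte_fin -E Lgt0.
Qed.

Lemma lc_decay_RLint n (f : 'rV[R]_n -> R) : lc_decay f ->
  Lint (EFin \o f) = (RLint f)%:E /\ 0 < RLint f.
Proof.
move=> [f0 _ mf [C [c [c0 fC]]]].
by have [-> /andP[]] := RLint_decay c0 f0 mf fC.
Qed.

Lemma lc_decay_slice n (f : 'rV[R]_n.+1 -> R) x : lc_decay f ->
  lc_decay (fun v => f (rowcons x v)).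
Proof.
move=> [f0 lcf mf [C [c [c0 fC]]]]; split => //.
- move=> u v l l01; have := lcf (rowcons x u) (rowcons x v) l l01.
  rewrite (_ : _ *: _ + _ = rowcons x ((1 - l) *: u + l *: v))//.
  apply/rowP => i; case: (unliftP ord0 i) => [j|] ->; rewrite !mxE ?liftK/= ?unlift_none/= ?mxE//.
  by ring.
- exact: mrow_slice.
exists (C * expR (- (c * `|x|))), c; split => // v.
by rewrite -mulrA -expl1_cons.
Qed.

(** By induction on the dimension: the induction hypothesis for slices says that the slice integrals
    satisfy the hypotheses of the one-dimensional inequality, and Tonelli recovers the full
    integrals from them. *)
Lemma prekopa n (f g m : 'rV[R]_n -> R) l : 0 < l < 1 ->
  lc_decay f -> lc_decay g -> lc_decay m ->
  (forall a b, (1 - l) * ln (f a) + l * ln (g b) <= ln (m ((1 - l) *: a + l *: b))) ->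
  (1 - l) * ln (RLint f) + l * ln (RLint g) <= ln (RLint m).
Proof.
elim: n f g m l => [|n IH] f g m l l01 lcf lcg lcm fgm.
  rewrite /RLint !Lint0/=; apply: le_trans (fgm 0 0) _.
  by rewrite !scaler0 addr0.
have rc_comb t x y (u v : 'rV[R]_n) : (1 - t) *: rowcons x u + t *: rowcons y v =
    rowcons ((1 - t) * x + t * y) ((1 - t) *: u + t *: v).
  apply/rowP => i; case: (unliftP ord0 i) => [j|] ->; rewrite !mxE ?liftK/= ?unlift_none/= ?mxE//.
pose S (h : 'rV[R]_n.+1 -> R) x := RLint (fun v => h (rowcons x v)).
have S0 h x : lc_decay h -> 0 < S h x.
  by move=> lch; have [] := lc_decay_RLint (lc_decay_slice x lch).
have mS h : lc_decay h -> measurable_fun [set: measurableTypeR R] (S h).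
  move=> [h0 _ mh _]; apply: measurableT_comp => //.
  apply: (@measurable_Lint_slice _ _ (EFin \o h)); first exact: mrow_EFin.
  by move=> v; rewrite lee_fin ltW.
have IS h : lc_decay h -> (\int[mu]_x (S h x)%:E = (RLint h)%:E)%E.
  move=> lch; have [<- _] := lc_decay_RLint lch.
  rewrite Lint_cons1; last 2 first.
  - by apply: mrow_EFin; case: lch.
  - by move=> v; rewrite lee_fin ltW//; case: lch.
  apply: eq_integral => x _.
  by have [-> _] := lc_decay_RLint (lc_decay_slice x lch).
(* The decay constant of a slice at [x] is the original one times a factor at most 1, hence a bound
   uniform in [x]. *)
have ubS h : lc_decay h -> has_ubound (range (S h)).
  move=> lch; have [h0 _ mh [C [c [c0 hC]]]] := lch.
  have C0 : 0 <= C.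
    have := lt_le_trans (h0 0) (hC 0); rewrite pmulr_lgt0 ?expR_gt0//; exact: ltW.
  exists (C * (2 / c) ^+ n) => _ [x _ <-].
  have hxC v : h (rowcons x v) <= C * expl1 c v.
    apply: le_trans (hC _) _; rewrite ler_wpM2l// expl1_cons.
    by rewrite ler_piMl ?expR_ge0// -expR0 ler_expR oppr_le0 mulr_ge0// ltW.
  by have [_ /andP[_]] := RLint_decay c0 (fun v => h0 (rowcons x v))
    (mrow_slice x mh) hxC.
apply: (@prekopa_R _ (S f) (S g) (S m)) => //.
- by move=> x; exact: S0.
- by move=> x; exact: S0.
- by move=> x; exact: S0.
- exact: mS.
- exact: mS.
- exact: mS.
- exact: ubS.
- exact: ubS.
(* The marginal of [m] is log-concave by the induction hypothesis for three slices of [m] itself. *)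
- move=> x y t t01; apply: IH => //; try exact: lc_decay_slice.
  move=> a b; rewrite -rc_comb; have [_ lm _ _] := lcm; exact: lm.
- move=> x y; apply: IH => //; try exact: lc_decay_slice.
  by move=> a b; rewrite -rc_comb.
- exact: IS.
- exact: IS.
- exact: IS.
- by have [] := lc_decay_RLint lcf.
- by have [] := lc_decay_RLint lcg.
Qed.

Lemma logconcave_marginal n (f : 'rV[R]_n.+1 -> R) : lc_decay f ->
  @logconcave _ R^o (fun x => RLint (fun v => f (rowcons x v))).
Proof.
move=> lcf x y t t01; apply: prekopa => //; try exact: lc_decay_slice.
move=> a b; have [_ lf _ _] := lcf; apply: le_trans (lf _ _ _ t01) _.
rewrite le_eqVlt; apply/orP; left; apply/eqP; congr (ln (f _)).
by apply/rowP => i; case: (unliftP ord0 i) => [j|] ->; rewrite !mxE ?liftK/= ?unlift_none/= ?mxE.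
Qed.

End prekopa.

(** * The section inequality *)

Section moment.
Context (R : realType).
Local Notation mu := (@lebesgue_measure R).

Let pos (F : R -> R) x := F x * (0 < x)%R%:R.

Let pos_ge0 F x : (forall x, 0 < F x) -> 0 <= pos F x.
Proof. by move=> F0; rewrite /pos mulr_ge0// ltW. Qed.

Let measurable_pos F : measurable_fun [set: measurableTypeR R] F ->
  measurable_fun [set: measurableTypeR R] (pos F).
Proof.
move=> mF; apply: measurable_funM => //.
rewrite (_ : (fun x : R => (0 < x)%R%:R : R) = \1_(`]0, +oo[)).
  by apply: measurable_indic => /=.
by apply/funext => x; rewrite indicE; congr ((nat_of_bool _)%:R); rewrite mem_setE in_itv/= andbT.
Qed.

(* Writing [(\int F)^2] as a double integral and substituting [s = u + v] gives
   [\int s F(s) F(0) ds] as a lower bound. *)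
Lemma half_moment (F : R -> R) : (forall x, 0 < F x) ->
  measurable_fun [set: measurableTypeR R] F ->
  (forall u v, 0 < u -> 0 < v -> F 0 * F (u + v) <= F u * F v) ->
  ((F 0)%:E * \int[mu]_x (x * pos F x)%:E <=
   (\int[mu]_x (pos F x)%:E) * (\int[mu]_x (pos F x)%:E))%E.
Proof.
move=> F0 mF FF.
have mp := measurable_pos mF.
have p0 x : 0 <= pos F x by exact: pos_ge0.
have Ep0 : (0 <= \int[mu]_x (pos F x)%:E)%E.
  by apply: integral_ge0 => x _; rewrite lee_fin.
have mEp : measurable_fun [set: measurableTypeR R] (EFin \o pos F).
  exact/measurable_EFinP.
rewrite -[leRHS]ge0_integralZl//; last by move=> x _; rewrite lee_fin.
(* [G (u, s)] is [F s] on [0 < u < s]: integrating out [u] produces the factor [s], while for fixed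
   [u] the substitution [s = u + v] produces [F (u + v)]. *)
pose G (p : measurableTypeR R * measurableTypeR R) : R :=
  pos F p.2 * (0 < p.1)%R%:R * (p.1 < p.2)%R%:R.
have G0 p : 0 <= G p.
  by rewrite /G mulr_ge0 ?ler0n//; apply: mulr_ge0; rewrite ?ler0n.
have mG : measurable_fun setT G.
  have mb (f g : measurableTypeR R * measurableTypeR R -> R) :
      measurable_fun setT f -> measurable_fun setT g ->
      measurable_fun setT (fun p => (f p < g p)%R%:R : R).
    move=> mf mg.
    rewrite (_ : (fun p => _) = \1_[set p | f p < g p]).
      apply: measurable_indic => /=.
      have mfg : measurable_fun setT (fun p => f p < g p).
        exact: measurable_fun_ltr.
      by have := mfg measurableT [set true] I; rewrite setTI.
    by apply/funext => p; rewrite indicE; congr ((nat_of_bool _)%:R); rewrite mem_setE.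
  apply: measurable_funM; last exact: mb.
  apply: measurable_funM; last exact: mb.
  exact: measurableT_comp.
have EG : (\int[mu]_x (x * pos F x)%:E = \int[mu]_s \int[mu]_u (G (u, s))%:E)%E.
  apply: eq_integral => s _; rewrite /G/=.
  under eq_integral do rewrite -mulrA EFinM.
  have mi : measurable_fun [set: measurableTypeR R]
      (fun x : R => ((0 < x)%R%:R * (x < s)%R%:R : R)%:E).
    rewrite (_ : (fun x => _) = EFin \o \1_(`]0, s[)).
      by apply/measurable_EFinP; exact: measurable_indic.
    apply/funext => x /=; rewrite indicE -natrM mulnb; congr ((nat_of_bool _)%:R%:E).
    by rewrite mem_setE in_itv.
  rewrite ge0_integralZl_EFin//.
  rewrite (_ : (fun x : R => _) = EFin \o \1_(`]0, s[)); last first.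
    apply/funext => x /=; rewrite indicE -natrM mulnb; congr ((nat_of_bool _)%:R%:E).
    by rewrite mem_setE in_itv.
  rewrite integral_indic// setIT.
  have muE : mu `]0, s[%classic = (if 0 < s then s else 0)%:E.
    etransitivity; first exact: lebesgue_measure_itv.
    by rewrite /= lte_fin; case: ifP => // _; rewrite oppr0 adde0.
  rewrite [X in _ = (_ * X)%E]muE.
  by rewrite -EFinM /pos; case: ifPn => s0; rewrite ?mulr0 ?mul0r// mulrC.
rewrite EG -(fubini_tonelli (fun p => (G p)%:E)); last 2 first.
- exact/measurable_EFinP.
- by move=> p; rewrite lee_fin.
have mGF : measurable_fun [set: measurableTypeR R] (fun u => \int[mu]_s (G (u, s))%:E)%E.
  apply: (@measurable_fun_fubini_tonelli_F _ _ _ _ _ mu (fun p => (G p)%:E)).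
    exact/measurable_EFinP.
  by move=> p; rewrite lee_fin.
have iG0 u : (0 <= \int[mu]_s (G (u, s))%:E)%E.
  by apply: integral_ge0 => s _; rewrite lee_fin.
rewrite -ge0_integralZl//; last by rewrite lee_fin ltW.
apply: ge0_le_integral => //.
- by move=> u _; rewrite mule_ge0// lee_fin ltW.
- exact: measurable_funeM.
- exact: measurable_funeM.
move=> u _.
have mGu : measurable_fun [set: measurableTypeR R] (fun s => (G (u, s))%:E).
  by apply/measurable_EFinP; exact: (measurableT_comp mG (measurable_pair1 u)).
have -> : (\int[mu]_s (G (u, s))%:E = \int[mu]_v (G (u, 1 * v + u)%R)%:E)%E.
  rewrite (@integral_affine R 1 u (fun s => (G (u, s))%:E)) ?oner_eq0//.
    by rewrite normr1 invr1 mul1e.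
  by move=> s; rewrite lee_fin.
have mGu1 : measurable_fun [set: measurableTypeR R]
    (fun v => (G (u, 1 * v + u)%R)%:E).
  exact: (measurableT_comp mGu (measurable_affine 1 u)).
rewrite [leRHS]muleC -ge0_integralZl_EFin//; last 2 first.
- by move=> v _; rewrite lee_fin.
- exact: ltW.
rewrite -ge0_integralZl_EFin//; last by move=> v _; rewrite lee_fin.
apply: ge0_le_integral => //.
- by move=> v _; rewrite mule_ge0// lee_fin// ltW.
- exact: measurable_funeM.
- exact: measurable_funeM.
move=> v _; rewrite -!EFinM lee_fin /G/= mul1r /pos.
have [u0|u0] := ltP 0 u; last by rewrite !mulr0 !mul0r ?mulr0.
have [v0|v0] := ltP 0 v; last first.
  by rewrite ltrDr (ltNge 0 v) v0/= !mulr0.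
by rewrite addr_gt0// ltrDr v0 !mulr1 addrC; exact: FF.
Qed.

(** By evenness the moment is twice that over the half-line, and the half-line integral [H]
    satisfies [2 H <= J]. So [half_moment] bounds the left side by [2 H^2 <= J^2 / 2]. *)
Lemma even_moment (F : R -> R) (J : R) : (forall x, 0 < F x) ->
  measurable_fun [set: measurableTypeR R] F ->
  (forall u v, 0 < u -> 0 < v -> F 0 * F (u + v) <= F u * F v) ->
  (forall x, F (- x) = F x) -> (\int[mu]_x (F x)%:E = J%:E)%E ->
  ((F 0)%:E * \int[mu]_x (`|x| * F x)%:E <= (J ^+ 2 / 2)%:E)%E.
Proof.
move=> F0 mF FF Feven FJ.
have mp := measurable_pos mF.
have p0 x : 0 <= pos F x by exact: pos_ge0.
have xp0 x : 0 <= x * pos F x.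
  rewrite /pos; have [x0|x0] := ltP 0 x; last by rewrite !mulr0.
  by rewrite mulr1 mulr_ge0// ltW.
have mEp : measurable_fun [set: measurableTypeR R] (EFin \o pos F).
  exact/measurable_EFinP.
have mxp : measurable_fun [set: measurableTypeR R] (fun x => (x * pos F x)%:E).
  by apply/measurable_EFinP; exact: measurable_funM.
have refl (f : R -> \bar R) : measurable_fun [set: measurableTypeR R] f ->
    (forall x, 0 <= f x)%E ->
    (\int[mu]_x (f x + f (-1 * x + 0)%R) = 2%:E * \int[mu]_x f x)%E.
  move=> mf f0; rewrite ge0_integralD//; last first.
    exact: (measurableT_comp mf (measurable_affine (-1) 0)).
  rewrite integral_affine ?oppr_eq0 ?oner_eq0// normrN normr1 invr1 mul1e.
  by rewrite -[X in (X + X)%E]mul1e -ge0_muleDl ?lee_fin// -EFinD.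
set H := (\int[mu]_x (pos F x)%:E)%E.
have H0 : (0 <= H)%E by apply: integral_ge0 => x _; rewrite lee_fin.
have HJ : (2%:E * H <= J%:E)%E.
  have pf0 x : (0 <= (EFin \o pos F) x)%E by rewrite lee_fin.
  rewrite -FJ -(refl _ mEp pf0).
  apply: ge0_le_integral => //.
  - by move=> x _; rewrite adde_ge0.
  - apply: emeasurable_funD => //.
    exact: (measurableT_comp mEp (measurable_affine (-1) 0)).
  - exact/measurable_EFinP.
  move=> x _ /=; rewrite -EFinD lee_fin mulN1r addr0 /pos Feven oppr_gt0.
  case: (ltgtP x 0) => _; rewrite ?mulr0 ?mulr1 ?add0r ?addr0//.
  exact: ltW.
have Hfin : H \is a fin_num.
  rewrite ge0_fin_numE//; apply: (@le_lt_trans _ _ J%:E); last exact: ltry.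
  by apply: le_trans HJ; rewrite -[leLHS]mul1e lee_wpmul2r// lee_fin ler1n.
have J0 : 0 <= J by rewrite -lee_fin -FJ; apply: integral_ge0 => x _; rewrite lee_fin ltW.
have absE x : (`|x| * F x)%:E =
    (x * pos F x)%:E + (fun x => (x * pos F x)%:E) (-1 * x + 0)%R :> \bar R.
  rewrite -EFinD mulN1r addr0 /pos Feven oppr_gt0; congr (_%:E).
  case: (ltgtP x 0) => x0; rewrite ?mulr0 ?mulr1 ?add0r ?addr0.
  - by rewrite ltr0_norm.
  - by rewrite gtr0_norm.
  - by rewrite x0 normr0 mul0r.
under eq_integral do rewrite absE.
have xpf0 x : (0 <= (x * pos F x)%:E)%E by rewrite lee_fin.
rewrite (refl _ mxp xpf0).
rewrite muleCA; apply: (@le_trans _ _ (2%:E * (H * H))%E).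
  by rewrite lee_wpmul2l ?lee_fin//; exact: half_moment.
move: HJ H0; rewrite -(fineK Hfin) -!EFinM !lee_fin => HJ H0.
set h := fine H in HJ H0 *; nra.
Qed.

End moment.

Section dot_product.
Context (R : realType) (n : nat).
Implicit Types x y z : 'rV[R]_n.

Lemma dotpC x y : dotp x y = dotp y x.
Proof. by apply: eq_bigr => i _; rewrite mulrC. Qed.

Lemma dotp_linear a b x y z : dotp (a *: x + b *: y) z = a * dotp x z + b * dotp y z.
Proof.
rewrite /dotp !mulr_sumr -big_split/=; apply: eq_bigr => i _.
by rewrite !mxE; ring.
Qed.

Lemma dotpZl a x z : dotp (a *: x) z = a * dotp x z.
Proof. by have := dotp_linear a 0 x x z; rewrite scale0r addr0 mul0r addr0. Qed.

Lemma dotpDl x y z : dotp (x + y) z = dotp x z + dotp y z.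
Proof. by have := dotp_linear 1 1 x y z; rewrite !scale1r !mul1r. Qed.

Lemma dotpBl x y z : dotp (x - y) z = dotp x z - dotp y z.
Proof. by have := dotp_linear 1 (-1) x y z; rewrite scale1r scaleN1r mul1r mulN1r. Qed.

Lemma dotp0l z : dotp 0 z = 0.
Proof. by have := dotpZl 0 0 z; rewrite scaler0 mul0r. Qed.

Lemma dotpZr a x z : dotp x (a *: z) = a * dotp x z.
Proof. by rewrite dotpC dotpZl dotpC. Qed.

Lemma dotpDr x y z : dotp x (y + z) = dotp x y + dotp x z.
Proof. by rewrite dotpC dotpDl !(dotpC x). Qed.

Lemma dotpBr x y z : dotp x (y - z) = dotp x y - dotp x z.
Proof. by rewrite dotpC dotpBl !(dotpC x). Qed.

Lemma dotp_sumr I (r : seq I) (F : I -> 'rV[R]_n) x :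
  dotp x (\sum_(i <- r) F i) = \sum_(i <- r) dotp x (F i).
Proof.
elim: r => [|i r IH]; first by rewrite !big_nil dotpC dotp0l.
by rewrite !big_cons dotpDr IH.
Qed.

Lemma continuous_sumr (T : topologicalType) I (r : seq I) (F : I -> T -> R) :
  (forall i, continuous (F i)) -> continuous (fun t => \sum_(i <- r) F i t).
Proof.
move=> cF; elim: r => [|i r IH].
  by under eq_fun do rewrite big_nil; exact: cst_continuous.
under eq_fun do rewrite big_cons.
by move=> t; apply: (@continuousD _ R^o); [exact: cF|exact: IH].
Qed.

Lemma continuous_dotpl y : continuous (fun x => dotp x y).
Proof.
apply: continuous_sumr => i x; apply: (@continuousM _ _ (fun x : 'rV[R]_n => x ord0 i)).
  exact: coord_continuous.
exact: cst_continuous.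
Qed.

Lemma le_coord_norm x i : `|x ord0 i| <= `|x|.
Proof.
rewrite /Num.norm/= mx_normrE.
exact: (@le_bigmax _ _ _ _ (fun ij : 'I_1 * 'I_n => `|x ij.1 ij.2|) (ord0, i)).
Qed.

Lemma sum_coord_le_norm x : \sum_i `|x ord0 i| <= n%:R * `|x|.
Proof.
have : \sum_(i < n) `|x ord0 i| <= \sum_(i < n) `|x|.
  by apply: ler_sum => i _; exact: le_coord_norm.
by rewrite sumr_const card_ord mulr_natl.
Qed.

Lemma normr_dotp_le x y : `|dotp x y| <= n%:R * `|x| * `|y|.
Proof.
apply: le_trans (ler_norm_sum _ _ _) _.
apply: (@le_trans _ _ (\sum_i `|x ord0 i| * `|y|)).
  apply: ler_sum => i _; rewrite normrM ler_wpM2l//; exact: le_coord_norm.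
by rewrite -mulr_suml ler_wpM2r//; exact: sum_coord_le_norm.
Qed.

(** The constant is the minimum of [h] over the compact unit sphere of the sup norm. *)
Lemma homogeneous_ge_norm (h : 'rV[R]_n -> R) : continuous h ->
  (forall a x, h (a *: x) = `|a| * h x) -> (forall x, x != 0 -> 0 < h x) ->
  exists2 c, 0 < c & forall x, c * `|x| <= h x.
Proof.
move=> ch hZ h0.
have h00 : h 0 = 0 by have := hZ 0 0; rewrite scaler0 normr0 mul0r.
pose S := [set x : 'rV[R]_n | `|x| = 1].
have normS x : x != 0 -> S (`|x|^-1 *: x).
  by move=> x0; rewrite /S/= normrZ normfV normr_id mulVf// normr_eq0.
have [S0|S0] := pselect (S !=set0); last first.
  (* The sphere is empty only when every vector is 0, that is for [n = 0]. *)
  exists 1 => // x; have [->|x0] := eqVneq x 0; first by rewrite normr0 h00 mulr0.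
  by exfalso; apply: S0; exists (`|x|^-1 *: x); exact: normS.
have cS : compact S.
  apply: bounded_closed_compact.
    exists 1; split => // M M1 x /= ->; exact: ltW.
  rewrite (_ : S = (Num.norm : 'rV[R]_n -> R) @^-1` [set 1])//.
  by apply: closed_comp => [x _|]; [exact: norm_continuous|exact: closed_eq].
have [x0 Sx0 hx0] := EVT_min_rV S0 cS (continuous_subspaceT ch).
have x00 : x0 != 0.
  apply: contraPneq Sx0 => ->; rewrite inE /S/= normr0 => /esym/eqP.
  by rewrite oner_eq0.
exists (h x0); first exact: h0.
move=> x; have [->|xn0] := eqVneq x 0; first by rewrite normr0 h00 mulr0.
have nx : 0 < `|x| by rewrite normr_gt0.
rewrite -ler_pdivlMr// mulrC.
have -> : `|x|^-1 * h x = h (`|x|^-1 *: x) by rewrite hZ normfV normr_id.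
by apply: hx0; rewrite inE; exact: normS.
Qed.

End dot_product.

(** * Families of vectors, their support functions and shears *)

Section families.
Context (R : realType).
Local Notation mu := (@lebesgue_measure R).

(* The support function of the zonotope [zono (fun=> 1) Y] below. *)
Definition hfam N n (Y : 'I_N -> 'rV[R]_n) x : R := \sum_j `|dotp x (Y j)|.

(** Spanning in dual form: a vector orthogonal to every [Y j] is 0, so that [hfam Y] is a norm. *)
Definition spans N n (Y : 'I_N -> 'rV[R]_n) := forall x, hfam Y x = 0 -> x = 0.

Definition expfam N n (Y : 'I_N -> 'rV[R]_n) x : R := expR (- hfam Y x).

Section fam.
Variables (N n : nat) (Y : 'I_N -> 'rV[R]_n).

Lemma hfam_ge0 x : 0 <= hfam Y x.
Proof. by apply: sumr_ge0. Qed.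

Lemma hfamZ a x : hfam Y (a *: x) = `|a| * hfam Y x.
Proof. by rewrite /hfam mulr_sumr; apply: eq_bigr => j _; rewrite dotpZl normrM. Qed.

Lemma hfam_convex a b x y :
  hfam Y (a *: x + b *: y) <= `|a| * hfam Y x + `|b| * hfam Y y.
Proof.
rewrite /hfam !mulr_sumr -big_split/=; apply: ler_sum => j _.
by rewrite dotp_linear (le_trans (ler_normD _ _))// !normrM.
Qed.

Lemma continuous_hfam : continuous (hfam Y).
Proof.
apply: continuous_sumr => j x; apply: (@continuous_comp _ _ _ (fun x => dotp x (Y j)) Num.norm).
  exact: continuous_dotpl.
exact: norm_continuous.
Qed.

Lemma continuous_expfam : continuous (expfam Y).
Proof.
move=> x; apply: (@continuous_comp _ _ _ (fun x => - hfam Y x) expR).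
  by apply: (@continuousN _ R^o); exact: continuous_hfam.
exact: continuous_expR.
Qed.

Lemma spans_ge : spans Y -> exists2 c, 0 < c & forall x, c * `|x| <= hfam Y x.
Proof.
move=> sY; apply: homogeneous_ge_norm.
- exact: continuous_hfam.
- exact: hfamZ.
- move=> x x0; rewrite lt_neqAle hfam_ge0 andbT eq_sym.
  by apply: contraNneq x0 => /sY ->.
Qed.

Lemma lc_decay_expfam : spans Y -> lc_decay (expfam Y).
Proof.
move=> /spans_ge[c c0 hc]; split.
- by move=> v; exact: expR_gt0.
- move=> x y l /andP[l0 l1]; rewrite !expRK.
  have := hfam_convex (1 - l) l x y.
  rewrite (ger0_norm (ltW l0)) (@ger0_norm _ (1 - l)); lra.
- by apply: continuous_mrow; exact: continuous_expfam.
(* The l1 norm is at most [n] times the sup norm; [n.+1] replaces [n] to keep the denominator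
   nonzero. *)
exists 1, (c / n.+1%:R); split; first by rewrite divr_gt0.
move=> v; rewrite mul1r ler_expR lerN2; apply: le_trans (hc v).
rewrite -mulrA ler_pM2l// ler_pdivrMl//.
apply: le_trans (sum_coord_le_norm v) _.
by rewrite ler_wpM2r// ler_nat.
Qed.

End fam.

Definition rtail n (v : 'rV[R]_n.+1) : 'rV[R]_n := \row_i v ord0 (lift ord0 i).

Lemma rtail_cons n x (v : 'rV[R]_n) : rtail (rowcons x v) = v.
Proof. by apply/rowP => i; rewrite mxE rowconsS. Qed.

Lemma rowcons_tail n (v : 'rV[R]_n.+1) : rowcons (v ord0 ord0) (rtail v) = v.
Proof. by rewrite -rowcons_surj. Qed.

(* A vector with nonzero first coordinate a is written a (1, w). Hyperplanes
   <x, (1, w)> = t are parametrized by the last n coordinates of x, which turns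
   the projection of Y along (1, w) into [pfam w Y] : (y_0, y') |-> y' - y_0 w.
   Changing the first coordinate of x to <x, (1, w)> transforms Y into
   [shfam w Y]. *)
Definition pfam N n (w : 'rV[R]_n) (Y : 'I_N -> 'rV[R]_n.+1) (j : 'I_N) : 'rV[R]_n :=
  rtail (Y j) - Y j ord0 ord0 *: w.

Definition shfam N n (w : 'rV[R]_n) (Y : 'I_N -> 'rV[R]_n.+1) (j : 'I_N) :=
  rowcons (Y j ord0 ord0) (pfam w Y j).

Definition shear n (w : 'rV[R]_n) (v : 'rV[R]_n.+1) :=
  rowcons (v ord0 ord0 - dotp (rtail v) w) (rtail v).

(** The inverse of the adjoint of [shear w]: it acts on the points of the zonotope, [shear w] on the
    argument of its support function. It carries parallels to the first axis to lines of direction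
    (1, w), keeping the first coordinate as parameter. *)
Definition coshear n (w : 'rV[R]_n) (v : 'rV[R]_n.+1) :=
  rowcons (v ord0 ord0) (rtail v + v ord0 ord0 *: w).

Lemma continuous_rtail n : continuous (@rtail n).
Proof.
apply: continuous_row => i; under eq_fun do rewrite mxE.
exact: coord_continuous.
Qed.

Lemma continuous_rowcons n (T : topologicalType) (f : T -> R) (g : T -> 'rV[R]_n) :
  continuous f -> continuous g -> continuous (fun t => rowcons (f t) (g t)).
Proof.
move=> cf cg; apply: continuous_row => i; case: (unliftP ord0 i) => [j|] ->.
  under eq_fun do rewrite rowconsS.
  move=> t; apply: (@continuous_comp _ _ _ g (fun v : 'rV[R]_n => v ord0 j)) => //.
    exact: cg.
  exact: coord_continuous.
by under eq_fun do rewrite rowcons0.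
Qed.

Lemma continuous_shear n (w : 'rV[R]_n) : continuous (shear w).
Proof.
apply: continuous_rowcons; last exact: continuous_rtail.
have c1 : continuous (fun v : 'rV[R]_n.+1 => dotp (rtail v) w).
  move=> v; apply: (@continuous_comp _ _ _ (@rtail n) (fun v => dotp v w)).
    exact: continuous_rtail.
  exact: continuous_dotpl.
move=> v; apply: (@cvgB _ R^o); first exact: nbhs_filter.
  exact: coord_continuous.
exact: c1.
Qed.

Lemma continuous_coshear n (w : 'rV[R]_n) : continuous (coshear w).
Proof.
apply: continuous_rowcons; first exact: coord_continuous.
move=> v; apply: continuousD; first exact: continuous_rtail.
apply: (@continuousZl _ _ _ (fun v : 'rV[R]_n.+1 => v ord0 ord0)).
exact: coord_continuous.
Qed.

(** For a fixed tail the shear merely translates the first coordinate; in [Lint_coshear] the roles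
    are exchanged. *)
Lemma Lint_shear n (w : 'rV[R]_n) (f : 'rV[R]_n.+1 -> \bar R) : mrow f ->
  (forall v, 0 <= f v)%E -> Lint (fun v => f (shear w v)) = Lint f.
Proof.
move=> mf f0; have mfs := mrow_comp (@continuous_shear n w) mf.
rewrite (Lint_cons2 mfs (fun v => f0 _)) (Lint_cons2 mf f0); apply: eq_Lint => v /=.
under eq_integral do rewrite /shear rowcons0 rtail_cons -[X in X - _]mul1r.
rewrite (@integral_affine R 1 (- dotp v w) (fun x => f (rowcons x v))) ?oner_eq0//.
  by rewrite normr1 invr1 mul1e.
exact: mrow_slice1.
Qed.

Lemma Lint_coshear n (w : 'rV[R]_n) (f : 'rV[R]_n.+1 -> \bar R) : mrow f ->
  (forall v, 0 <= f v)%E -> Lint (fun v => f (coshear w v)) = Lint f.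
Proof.
move=> mf f0; have mfs := mrow_comp (@continuous_coshear n w) mf.
rewrite (Lint_cons1 mfs (fun v => f0 _)) (Lint_cons1 mf f0); apply: eq_integral => x _ /=.
rewrite (eq_Lint (g := fun v => f (rowcons x (1 *: v + x *: w)))); last first.
  by move=> v; rewrite /coshear rowcons0 rtail_cons scale1r.
rewrite (@Lint_affine _ _ 1 (x *: w) (fun v => f (rowcons x v))) ?oner_eq0//.
  by rewrite normr1 expr1n invr1 mul1e.
exact: mrow_slice.
Qed.

Lemma dotp_shear n (w : 'rV[R]_n) x y :
  dotp (shear w x) y = dotp x (rowcons (y ord0 ord0) (rtail y - y ord0 ord0 *: w)).
Proof.
rewrite /shear -[in LHS](rowcons_tail y) -[in RHS](rowcons_tail x) !dotp_rowcons.
by rewrite dotpBr dotpZr; ring.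
Qed.

Lemma hfam_shear N n (w : 'rV[R]_n) (Y : 'I_N -> 'rV[R]_n.+1) x :
  hfam Y (shear w x) = hfam (shfam w Y) x.
Proof. by apply: eq_bigr => j _; rewrite dotp_shear. Qed.

Lemma hfam_shfam0 N n (w : 'rV[R]_n) (Y : 'I_N -> 'rV[R]_n.+1) v :
  hfam (shfam w Y) (rowcons 0 v) = hfam (pfam w Y) v.
Proof. by apply: eq_bigr => j _; rewrite /shfam dotp_rowcons mul0r add0r. Qed.

Lemma spans_shfam N n (w : 'rV[R]_n) (Y : 'I_N -> 'rV[R]_n.+1) :
  spans Y -> spans (shfam w Y).
Proof.
move=> sY x; rewrite -hfam_shear => /sY s0.
have t0 : rtail x = 0.
  by apply/rowP => i; rewrite !mxE; have := congr1 (fun v => rtail v ord0 i) s0;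
     rewrite /shear rtail_cons !mxE.
have := congr1 (fun v : 'rV[R]_n.+1 => v ord0 ord0) s0.
rewrite /shear rowcons0 t0 dotp0l subr0 mxE => x0.
rewrite -(rowcons_tail x) t0 x0; apply/rowP => i.
by case: (unliftP ord0 i) => [j|] ->; rewrite ?rowconsS ?rowcons0 !mxE.
Qed.

Lemma spans_pfam N n (w : 'rV[R]_n) (Y : 'I_N -> 'rV[R]_n.+1) :
  spans Y -> spans (pfam w Y).
Proof.
move=> /(@spans_shfam _ _ w) sY v; rewrite -hfam_shfam0 => /sY/(congr1 (@rtail n)).
by rewrite rtail_cons => ->; apply/rowP => i; rewrite !mxE.
Qed.

End families.

Section section_bound.
Context (R : realType).
Local Notation mu := (@lebesgue_measure R).

(** This stands for letting [e] tend to 0 in every approximation below. On [[0, 1]] the convex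
    function [(1 + e)^n] lies under its chord [1 + e (2^n - 1)], which gives an explicit [e]
    refuting [y < x]. *)
Lemma le_scale_limit n (x y : R) : 0 <= y ->
  (forall e, 0 < e <= 1 -> x <= (1 + e) ^+ n * y) -> x <= y.
Proof.
move=> y0 H; rewrite leNgt; apply/negP => yx.
have pow (e : R) : 0 <= e <= 1 -> (1 + e) ^+ n <= 1 + e * (2 ^+ n - 1).
  move=> /andP[e0 e1]; elim: n {H} => [|m IH]; first by rewrite !expr0 subrr mulr0 addr0.
  rewrite !exprS; have : 1 <= (2 : R) ^+ m by rewrite exprn_ege1// ler1n.
  move: IH; set p := (1 + e) ^+ m; set q := 2 ^+ m => IH q1.
  have : (1 + e) * p <= (1 + e) * (1 + e * (q - 1)) by rewrite ler_wpM2l//; lra.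
  have : 0 <= e * (1 - e) * (q - 1) by rewrite !mulr_ge0//; lra.
  lra.
have q1 : 1 <= (2 : R) ^+ n by rewrite exprn_ege1// ler1n.
set q := 2 ^+ n in pow q1.
have qy : 0 <= q * y by rewrite mulr_ge0//; lra.
pose d := (x - y) / (2 * (q * y + 1)).
have d0 : 0 < d by rewrite divr_gt0//; lra.
have dE : d * (2 * (q * y + 1)) = x - y by rewrite /d divfK// gt_eqF//; lra.
pose e := Num.min 1 d.
have e01 : 0 < e <= 1 by rewrite /e lt_min ltr01 d0 ge_min lexx.
have ed : e <= d by rewrite /e ge_min lexx orbT.
have := H _ e01; have /andP[e0 e1] := e01.
have : (1 + e) ^+ n * y <= (1 + e * (q - 1)) * y by rewrite ler_wpM2r// pow// (ltW e0).
have : e * (q * y) <= d * (q * y) by rewrite ler_wpM2r.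
nra.
Qed.

(** A mean value bound with the derivative overestimated by [m (1 + s)^m]: after division by [s],
    the remaining power is of the form that [le_scale_limit] removes. *)
Lemma expr1D_le m (s : R) : 0 <= s -> (1 + s) ^+ m <= 1 + m%:R * s * (1 + s) ^+ m.
Proof.
move=> s0; elim: m => [|m IH]; first by rewrite mul0r mul0r addr0 expr0.
rewrite exprS -natr1; have := @ler0n R m.
have : 1 <= (1 + s) ^+ m by rewrite exprn_ege1//; lra.
set p := (1 + s) ^+ m in IH *; set q := m%:R in IH *; nra.
Qed.

Section fam.
Variables (N n : nat) (Y : 'I_N -> 'rV[R]_n).
Hypothesis sY : spans Y.
Local Notation I := (RLint (expfam Y)).

Lemma Lint_expfam : Lint (EFin \o expfam Y) = I%:E.
Proof. by have [] := lc_decay_RLint (lc_decay_expfam sY). Qed.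

Lemma RLint_expfam_gt0 : 0 < I.
Proof. by have [] := lc_decay_RLint (lc_decay_expfam sY). Qed.

Lemma mrow_expfam : mrow (expfam Y : _ -> measurableTypeR R).
Proof. by apply: continuous_mrow; exact: continuous_expfam. Qed.

Lemma Lint_expfam_scale s : 0 < s ->
  Lint (fun v => (expfam Y (s *: v))%:E) = (s ^- n * I)%:E.
Proof.
move=> s0; rewrite (eq_Lint (g := fun v => (EFin \o expfam Y) (s *: v + 0))); last first.
  by move=> v; rewrite addr0.
rewrite (@Lint_affine R n s 0 (EFin \o expfam Y)) ?gt_eqF//.
- by rewrite Lint_expfam -EFinM gtr0_norm.
- exact: mrow_EFin mrow_expfam.
- by move=> v; rewrite lee_fin expR_ge0.
Qed.

Lemma mrow_dotp_expfam y :
  mrow (fun v => `|dotp v y| * expfam Y v : measurableTypeR R).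
Proof.
apply: continuous_mrow => v; apply: (@continuousM _ _ (fun v => `|dotp v y|)).
  apply: (@continuous_comp _ _ _ (fun x => dotp x y) Num.norm).
    exact: continuous_dotpl.
  exact: norm_continuous.
exact: continuous_expfam.
Qed.

(* [s |-> \int exp(-s h)] equals [s^-n I], and [exp] is convex: this replaces
   differentiating at [s = 1]. *)
Lemma Euler_expfam (q : 'I_N -> R) :
  (forall j, Lint (fun v => (`|dotp v (Y j)| * expfam Y v)%:E) <= (q j)%:E)%E ->
  n%:R * I <= \sum_j q j.
Proof.
move=> hq.
have I0 := ltW RLint_expfam_gt0.
have q0 j : 0 <= q j.
  rewrite -lee_fin; apply: le_trans (hq j); apply: Lint_ge0 => v.
  by rewrite lee_fin mulr_ge0// expR_ge0.
have hS : (Lint (fun v => (hfam Y v * expfam Y v)%:E) <= (\sum_j q j)%:E)%E.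
  rewrite (eq_Lint (g := fun v => \sum_j (`|dotp v (Y j)| * expfam Y v)%:E)%E); last first.
    by move=> v; rewrite /hfam mulr_suml sumEFin.
  rewrite /Lint ge0_integral_sum//; last 2 first.
  - by move=> j; exact: (mrow_EFin (mrow_dotp_expfam (Y j))).
  - by move=> j v _; rewrite lee_fin mulr_ge0// expR_ge0.
  by rewrite -sumEFin; apply: lee_sum => j _; exact: hq.
apply: (@le_scale_limit n); first exact: sumr_ge0.
move=> e /andP[e0 e1].
have mh : mrow (fun v => (hfam Y v * expfam Y v)%:E).
  apply: (@mrow_EFin R n (fun v => hfam Y v * expfam Y v)).
  apply: continuous_mrow => v.
  by apply: (@continuousM _ _ (hfam Y)); [exact: continuous_hfam|exact: continuous_expfam].
have h0 v : (0 <= (hfam Y v * expfam Y v)%:E)%E.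
  by rewrite lee_fin mulr_ge0 ?expR_ge0 ?hfam_ge0.
have mes : mrow (fun v => (expfam Y ((1 + e) *: v))%:E).
  apply: (@mrow_comp _ _ _ _ _ (EFin \o expfam Y) (fun v => (1 + e) *: v)).
    exact: scaler_continuous.
  exact: mrow_EFin mrow_expfam.
(* Pointwise, with [a = hfam Y v], this is [exp(-a) <= exp(-(1 + e) a) + e a exp(-a)], a consequence
   of [1 - e a <= exp(-e a)]. *)
have : (I%:E <= ((1 + e) ^- n * I)%:E + e%:E * (\sum_j q j)%:E)%E.
  rewrite -Lint_expfam -Lint_expfam_scale ?addr_gt0//.
  apply: (@le_trans _ _ (Lint (fun v => (expfam Y ((1 + e) *: v))%:E) +
      e%:E * Lint (fun v => (hfam Y v * expfam Y v)%:E))%E); last first.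
    by rewrite leeD2l// lee_wpmul2l// lee_fin ltW.
  rewrite -LintZl ?(ltW e0)//.
  rewrite [leRHS](_ : _ = Lint (fun v => (expfam Y ((1 + e) *: v))%:E +
      e%:E * (hfam Y v * expfam Y v)%:E)%E); last first.
    rewrite /Lint ge0_integralD//.
    - by move=> v _; rewrite lee_fin expR_ge0.
    - by move=> v _; rewrite mule_ge0// lee_fin ltW.
    - exact: measurable_funeM.
  apply: ge0_le_Lint.
  - by move=> v; rewrite lee_fin expR_ge0.
  - exact: mrow_EFin mrow_expfam.
  - by apply: emeasurable_funD => //; exact: measurable_funeM.
  move=> v; rewrite -EFinM -EFinD lee_fin /expfam hfamZ gtr0_norm ?addr_gt0//.
  have -> : - ((1 + e) * hfam Y v) = - hfam Y v + - (e * hfam Y v) by ring.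
  rewrite expRD; have := @expR_ge1Dx R (- (e * hfam Y v)).
  have := expR_gt0 (- hfam Y v).
  set a := expR _; set b := expR _; nra.
rewrite -EFinM -EFinD lee_fin.
have s0 : 0 < (1 + e) ^+ n by rewrite exprn_gt0// addr_gt0.
(* Bernoulli's inequality: multiplied by [s = (1 + e)^n], the estimate above reads
   [(s - 1) I <= e s S], and [n e <= s - 1] allows [e] to be cancelled. *)
have bern : 1 + n%:R * e <= (1 + e) ^+ n.
  elim: (n) => [|m IH]; first by rewrite mul0r addr0 expr0.
  rewrite exprS -natr1; have := @ler0n R m; set p := (1 + e) ^+ m in IH *.
  set k := m%:R in IH *; nra.
set s := (1 + e) ^+ n in s0 bern *; set S := \sum_j q j.
move=> H; have : s * I <= s * (s^-1 * I + e * S) by rewrite ler_pM2l.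
rewrite mulrDr mulVKf ?gt_eqF// => H2.
rewrite -(ler_pM2l e0).
have : (1 + n%:R * e) * I <= s * I by rewrite ler_wpM2r.
lra.
Qed.

End fam.

(** After the shear, [dotp v (Y j)] is [a] times the first coordinate, so the integral becomes [|a|]
    times the absolute first moment of the marginal [F], to which [even_moment] applies. [F 0] is
    the integral of the projected family. *)
Lemma section_moment N n (Y : 'I_N -> 'rV[R]_n.+1) (w : 'rV[R]_n) j : spans Y ->
  pfam w Y j = 0 ->
  (Lint (fun v => (`|dotp v (Y j)| * expfam Y v)%:E) <=
   (`|Y j ord0 ord0| * (RLint (expfam Y) ^+ 2 / 2) / RLint (expfam (pfam w Y)))%:E)%E.
Proof.
move=> sY Yj; set a := Y j ord0 ord0.
have sS := @spans_shfam _ _ _ w _ sY.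
have sP := @spans_pfam _ _ _ w _ sY.
have lcS := lc_decay_expfam sS.
pose F x := RLint (fun v => expfam (shfam w Y) (rowcons x v)).
have F0 x : 0 < F x by have [] := lc_decay_RLint (lc_decay_slice x lcS).
have FE x : Lint (fun v => (expfam (shfam w Y) (rowcons x v))%:E) = (F x)%:E.
  by have [] := lc_decay_RLint (lc_decay_slice x lcS).
have Fz : F 0 = RLint (expfam (pfam w Y)).
  by congr RLint; apply/funext => v; rewrite /expfam hfam_shfam0.
have mS : mrow (EFin \o expfam (shfam w Y)).
  by apply: mrow_EFin; exact: mrow_expfam.
have S0 v : (0 <= (EFin \o expfam (shfam w Y)) v)%E by rewrite lee_fin expR_ge0.
have lcF : @logconcave R R^o F by exact: logconcave_marginal lcS.
have mF : measurable_fun [set: measurableTypeR R] F.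
  exact: (measurableT_comp (@fine_measurable R setT measurableT)
    (measurable_Lint_slice mS S0)).
clearbody F.
have IF : (\int[mu]_x (F x)%:E = (RLint (expfam Y))%:E)%E.
  rewrite -Lint_expfam//.
  rewrite -(@Lint_shear R n w (EFin \o expfam Y)); last 2 first.
  - by apply: mrow_EFin; exact: mrow_expfam.
  - by move=> v; rewrite lee_fin expR_ge0.
  rewrite (eq_Lint (g := EFin \o expfam (shfam w Y))); last first.
    by move=> v; rewrite /= /expfam hfam_shear.
  by rewrite Lint_cons1//; apply: eq_integral => x _; rewrite -FE.
(* Reflect the last coordinates and use that [hfam] is even. *)
have Feven x : F (- x) = F x.
  suff : (F (- x))%:E = (F x)%:E by case.
  rewrite -(FE x) -(FE (- x)).
  have mx := mrow_slice x mS.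
  have x0 v : (0 <= (EFin \o expfam (shfam w Y)) (rowcons x v))%E by exact: S0.
  have m1 : (-1 : R) != 0 by rewrite oppr_eq0 oner_eq0.
  have H := Lint_affine 0 m1 mx x0.
  rewrite normrN normr1 expr1n invr1 mul1e in H.
  apply: etrans H.
  apply: eq_Lint => v; congr (_%:E); rewrite /expfam; congr (expR (- _)).
  rewrite -[LHS]mul1r -[X in X * _](normrN1 R) -hfamZ; congr hfam.
  by apply/rowP => i; case: (unliftP ord0 i) => [k|] ->;
    rewrite !mxE ?liftK ?unlift_none/= ?mxE ?mulN1r ?opprK ?addr0.
have FF u v : 0 < u -> 0 < v -> F 0 * F (u + v) <= F u * F v.
  move=> u0 v0; have uv : 0 < u + v by rewrite addr_gt0.
  rewrite -ler_ln ?posrE ?mulr_gt0// !lnM ?posrE//.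
  (* [u] and [v] divide the segment from 0 to [u + v] in complementary ratios; the two log-concavity
     inequalities are added. *)
  have l1 : 0 < u / (u + v) < 1.
    by apply/andP; split; [rewrite divr_gt0|rewrite ltr_pdivrMr// mul1r; lra].
  have l2 : 0 < v / (u + v) < 1.
    by apply/andP; split; [rewrite divr_gt0|rewrite ltr_pdivrMr// mul1r; lra].
  have := lcF 0 (u + v) _ l1; have := lcF 0 (u + v) _ l2.
  rewrite !scaler0 !add0r /GRing.scale/= !divfK ?gt_eqF// -!/(F _).
  have -> : v / (u + v) = 1 - u / (u + v) by field; rewrite gt_eqF.
  lra.
have key := even_moment F0 mF FF Feven IF.
have dE v : `|dotp (shear w v) (Y j)| = `|a| * `|v ord0 ord0|.
  rewrite dotp_shear -/(pfam w Y j) Yj -[in LHS](rowcons_tail v) dotp_rowcons.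
  by rewrite (dotpC _ 0) dotp0l addr0 normrM mulrC.
rewrite -(@Lint_shear R n w (fun v => (`|dotp v (Y j)| * expfam Y v)%:E)); last 2 first.
- exact: (mrow_EFin (mrow_dotp_expfam _ (Y j))).
- by move=> v; rewrite lee_fin mulr_ge0// expR_ge0.
have mg : mrow (fun v : 'rV[R]_n.+1 => (`|v ord0 ord0| * expfam (shfam w Y) v)%:E).
  apply: (@mrow_EFin R _ (fun v : 'rV[R]_n.+1 => `|v ord0 ord0| * expfam (shfam w Y) v)).
  apply: continuous_mrow => v.
  apply: (@continuousM _ _ (fun v : 'rV[R]_n.+1 => `|v ord0 ord0|)).
    apply: (@continuous_comp _ _ _ (fun v : 'rV[R]_n.+1 => v ord0 ord0) Num.norm).
      exact: coord_continuous.
    exact: norm_continuous.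
  exact: continuous_expfam.
have g0 (v : 'rV[R]_n.+1) : (0 <= (`|v ord0 ord0| * expfam (shfam w Y) v)%:E)%E.
  by rewrite lee_fin mulr_ge0// expR_ge0.
rewrite (eq_Lint (g := fun v => `|a|%:E *
    (`|v ord0 ord0| * expfam (shfam w Y) v)%:E)%E); last first.
  by move=> v; rewrite -EFinM dE /expfam hfam_shear mulrA.
rewrite (LintZl mg g0)//.
have -> : Lint (fun v : 'rV[R]_n.+1 => (`|v ord0 ord0| * expfam (shfam w Y) v)%:E) =
    (\int[mu]_x (`|x| * F x)%:E)%E.
  rewrite (Lint_cons1 mg g0); apply: eq_integral => x _.
  rewrite EFinM -FE -(LintZl (mrow_slice x mS))//.
  by apply: eq_Lint => v; rewrite rowcons0 EFinM.
rewrite -mulrA EFinM lee_wpmul2l ?lee_fin//.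
rewrite -Fz mulrC EFinM -lee_pdivrMl ?invr_gt0// invrK.
exact: key.
Qed.

Lemma section_inequality N n (Y : 'I_N -> 'rV[R]_n.+1) (w : 'I_N -> 'rV[R]_n) :
  spans Y -> (forall j, pfam (w j) Y j = 0) ->
  2 * n.+1%:R <= RLint (expfam Y) *
    \sum_j `|Y j ord0 ord0| / RLint (expfam (pfam (w j) Y)).
Proof.
move=> sY wY; have I0 := RLint_expfam_gt0 sY.
have := Euler_expfam sY (fun j => section_moment sY (wY j)).
set I := RLint (expfam Y) in I0 *.
under eq_bigr do rewrite mulrAC.
rewrite -mulr_suml; set S := \sum_j _.
rewrite expr2; nra.
Qed.

End section_bound.

(** * Zonotopes *)

Section zonotopes.
Context (R : realType).
Local Notation mu := (@lebesgue_measure R).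

Definition cross_proj n (w : 'rV[R]_n) (z : 'rV[R]_n.+1) : 'rV[R]_n :=
  rtail z - z ord0 ord0 *: w.

Lemma coshear_proj n (w : 'rV[R]_n) (z : 'rV[R]_n.+1) :
  coshear w (rowcons (z ord0 ord0) (cross_proj w z)) = z.
Proof. by rewrite /coshear rowcons0 rtail_cons /cross_proj subrK rowcons_tail. Qed.

(** Cavalieri's principle along the direction (1, w): [coshear w] preserves the integral and turns
    slices in the first coordinate into chords in that direction. *)
Lemma vol_lines n (w : 'rV[R]_n) (C : set 'rV[R]_n.+1) : mset C ->
  [/\ forall p, measurable ([set x | C (coshear w (rowcons x p))] : set (measurableTypeR R)),
     mrow (fun p => mu [set x | C (coshear w (rowcons x p))]) &
     vol C = Lint (fun p => mu [set x | C (coshear w (rowcons x p))])].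
Proof.
move=> mC; have mI := mrow_indic mC.
have mIc := mrow_comp (@continuous_coshear R n w) mI.
have mp p : measurable ([set x | C (coshear w (rowcons x p))] : set (measurableTypeR R)).
  have [_] := @measurable_indicP _ (measurableTypeR R) R [set x | C (coshear w (rowcons x p))].
  apply.
  have /measurable_EFinP := mrow_slice1 p mIc.
  by congr (measurable_fun _ _); apply/funext => x /=; rewrite !indicE.
have E p : mu [set x | C (coshear w (rowcons x p))] =
    (\int[mu]_x ((EFin \o (\1_C : _ -> R)) \o coshear w) (rowcons x p))%E.
  have := @integral_indic _ _ _ mu setT measurableT _ (mp p).
  rewrite setIT => <-; apply: eq_integral => x _ /=; by rewrite !indicE.
have I0 v : (0 <= (EFin \o (\1_C : _ -> R)) v)%E by rewrite lee_fin.
split => //.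
  rewrite (_ : (fun p => _) = fun p =>
    (\int[mu]_x ((EFin \o (\1_C : _ -> R)) \o coshear w) (rowcons x p))%E); last exact/funext.
  exact: (mrow_integral_slice mIc (fun v => I0 _)).
rewrite vol_Lint// -(Lint_coshear w mI I0).
rewrite (Lint_cons2 mIc (fun v => I0 _)).
by apply: eq_Lint => p; rewrite E.
Qed.

(* Integrating over the lines in the direction of the segment. *)
Lemma vol_add_segment n (A B : set 'rV[R]_n.+1) (w : 'rV[R]_n) (d : R) : 0 <= d ->
  mset A -> mset B -> mset [set cross_proj w z | z in A] ->
  (forall p, is_interval [set x | B (coshear w (rowcons x p))]) ->
  (forall z t, A z -> `|t| <= d -> B (z + t *: rowcons 1 w)) ->
  (vol A + (2 * d)%:E * vol [set cross_proj w z | z in A] <= vol B)%E.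
Proof.
move=> d0 mA mB mP iB AB.
have [mA1 mA2 ->] := vol_lines w mA; have [mB1 mB2 ->] := vol_lines w mB.
have d20 : 0 <= 2 * d by rewrite mulr_ge0.
have i0 v : (0 <= (EFin \o (\1_[set cross_proj w z | z in A] : _ -> R)) v)%E.
  by rewrite lee_fin.
rewrite (vol_Lint mP) -(LintZl (mrow_indic mP) i0 d20).
have mi : mrow (fun p =>
    (2 * d)%:E * (EFin \o (\1_[set cross_proj w z | z in A] : _ -> R)) p)%E.
  by apply: measurable_funeM; exact: mrow_indic.
have di0 v :
    (0 <= (2 * d)%:E * (EFin \o (\1_[set cross_proj w z | z in A] : _ -> R)) v)%E.
  by rewrite mule_ge0.
rewrite -LintD//; apply: ge0_le_Lint => //.
- by move=> p; rewrite adde_ge0.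
- exact: emeasurable_funD.
move=> p /=; rewrite indicE.
have [[x0 Ax0]|nA] := pselect ([set x | A (coshear w (rowcons x p))] !=set0); last first.
  have -> : [set x | A (coshear w (rowcons x p))] = set0.
    by apply/seteqP; split => // x Ax; apply: nA; exists x.
  rewrite memNset ?mule0 ?adde0 ?measure0//.
  move=> -[z Az zp]; apply: nA; exists (z ord0 ord0) => /=.
  by rewrite -zp coshear_proj.
rewrite mem_set ?mule1; last first.
  exists (coshear w (rowcons x0 p)) => //.
  by rewrite /cross_proj /coshear !rowcons0 !rtail_cons addrK.
have [->|] := eqVneq (mu [set x | B (coshear w (rowcons x p))]) +oo%E; first by rewrite leey.
rewrite -ltey => Bfin.
have BE : mu [set x | B (coshear w (rowcons x p))] \is a fin_num by rewrite ge0_fin_numE.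
have csh x t : coshear w (rowcons x p) + t *: rowcons 1 w = coshear w (rowcons (x + t) p).
  apply/rowP => i; rewrite /coshear !rowcons0 !rtail_cons.
  by case: (unliftP ord0 i) => [j|] ->; rewrite !mxE ?liftK ?unlift_none/= ?mxE; ring.
rewrite -(fineK BE) -leeBrDr// -EFinB.
(* If [a] and [b] lie on the chord of [A], that of [B] contains [[a - d, b + d]]; so the diameter of
   the former is at most the length of the latter minus [2 d]. *)
apply: (lebesgue_measure_le_diam _ (mA1 p)); first by exists x0.
move=> a b Aa Ab; rewrite lerBrDr -lee_fin fineK//.
have Ba : B (coshear w (rowcons (a - d) p)).
  by rewrite -csh; apply: AB => //; rewrite normrN ger0_norm.
have Bb : B (coshear w (rowcons (b + d) p)).
  by rewrite -csh; apply: AB => //; rewrite ger0_norm.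
apply: (@le_trans _ _ (mu `[a - d, b + d]%classic)).
  rewrite lebesgue_measure_itv/= lte_fin; case: ifPn => [_|].
    by rewrite -EFinB lee_fin; lra.
  by rewrite -leNgt lee_fin; lra.
apply: le_measure; rewrite ?inE//.
by move=> x /=; rewrite in_itv/= => xx; exact: (iB p _ _ Ba Bb x xx).
Qed.

(** The bounds [c] are kept apart from [Y] so that segments can be stretched one by one while the
    directions of projection stay fixed. *)
Definition zono N n (c : 'I_N -> R) (Y : 'I_N -> 'rV[R]_n) : set 'rV[R]_n :=
  [set z | exists2 s : 'I_N -> R, (forall j, `|s j| <= c j) & z = \sum_j s j *: Y j].

Section zono.
Variables (N n : nat).
Implicit Types (c : 'I_N -> R) (Y : 'I_N -> 'rV[R]_n).

Lemma compact_zono c Y : compact (zono c Y).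
Proof.
pose A := [set s : 'rV[R]_N | forall j, `[- c j, c j]%classic (s ord0 j)].
have cA : compact A.
  apply: (@rV_compact R N (fun j => `[- c j, c j]%classic)) => j.
  exact: segment_compact.
pose f (s : 'rV[R]_N) : 'rV[R]_n := \sum_j s ord0 j *: Y j.
have cf : continuous f.
  apply: continuous_row => i; under eq_fun do rewrite summxE.
  apply: continuous_sumr => j; under eq_fun do rewrite mxE.
  move=> s; apply: (@continuousM _ _ (fun s : 'rV[R]_N => s ord0 j)).
    exact: coord_continuous.
  exact: cst_continuous.
rewrite (_ : zono c Y = f @` A).
  by apply: continuous_compact => //; exact: continuous_subspaceT.
apply/seteqP; split => z.
  move=> [s sc ->]; exists (\row_j s j) => /=.
    by move=> j; rewrite mxE /= in_itv/= -ler_norml.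
  by apply: eq_bigr => j _; rewrite mxE.
move=> [s As <-]; exists (s ord0) => // j.
by have := As j; rewrite /A/= in_itv/= -ler_norml.
Qed.

Lemma mset_zono c Y : mset (zono c Y).
Proof.
apply: closed_mrow; apply: compact_closed; last exact: compact_zono.
exact: norm_hausdorff.
Qed.

Lemma zono_le c c' Y : (forall j, c j <= c' j) -> zono c Y `<=` zono c' Y.
Proof. by move=> cc z [s sc ->]; exists s => // j; exact: le_trans (cc j). Qed.

Lemma zono_convex c Y x y t : 0 <= t <= 1 -> zono c Y x -> zono c Y y ->
  zono c Y ((1 - t) *: x + t *: y).
Proof.
move=> /andP[t0 t1] [s sc ->] [r rc ->].
exists (fun j => (1 - t) * s j + t * r j).
  move=> j; apply: le_trans (ler_normD _ _) _; rewrite !normrM.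
  rewrite (ger0_norm t0) (@ger0_norm _ (1 - t)); last lra.
  have -> : c j = (1 - t) * c j + t * c j by ring.
  by rewrite lerD// ler_wpM2l//; lra.
rewrite !scaler_sumr -big_split/=; apply: eq_bigr => j _.
by rewrite !scalerA -scalerDl.
Qed.

Lemma zono_scale k c Y z : 0 < k -> zono c Y (k^-1 *: z) <-> zono (fun j => k * c j) Y z.
Proof.
move=> k0; split.
  move=> [s sc E]; exists (fun j => k * s j).
    by move=> j; rewrite normrM gtr0_norm// ler_pM2l.
  under eq_bigr do rewrite -scalerA.
  by rewrite -scaler_sumr -E scalerA divff ?gt_eqF// scale1r.
move=> [s sc ->]; exists (fun j => k^-1 * s j).
  by move=> j; rewrite normrM gtr0_norm ?invr_gt0// ler_pdivrMl.
by rewrite scaler_sumr; apply: eq_bigr => j _; rewrite scalerA.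
Qed.

Lemma vol_zono_scale k c Y : 0 < k ->
  vol (zono (fun j => k * c j) Y) = ((k ^+ n)%:E * vol (zono c Y))%E.
Proof.
move=> k0.
have -> : zono (fun j => k * c j) Y = [set z | zono c Y (k^-1 *: z + 0)].
  by apply/seteqP; split => z /=; rewrite addr0 zono_scale.
rewrite vol_affine ?invr_eq0 ?gt_eqF//; last exact: mset_zono.
by rewrite gtr0_norm ?invr_gt0// exprVn invrK.
Qed.

(** If the l1 norm is at most [K] on the zonotope, its indicator is at most [exp K] times the
    integrable function [expl1 1]. *)
Lemma vol_zono_fin c Y : vol (zono c Y) \is a fin_num.
Proof.
have [M [_ HM]] := compact_bounded (@compact_zono c Y).
pose K := n%:R * (Num.max 0 M + 1).
have me : mrow (EFin \o @expl1 R n 1) by apply: mrow_EFin; exact: measurable_expl1.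
have e0 v : (0 <= (EFin \o @expl1 R n 1) v)%E by rewrite lee_fin expR_ge0.
rewrite ge0_fin_numE ?vol_ge0//.
apply: (@le_lt_trans _ _ (Lint (fun v => (expR K)%:E * (EFin \o @expl1 R n 1) v)%E)).
  rewrite vol_Lint; last exact: mset_zono.
  apply: ge0_le_Lint.
  - by move=> v; rewrite lee_fin.
  - apply: mrow_indic; exact: mset_zono.
  - exact: measurable_funeM.
  move=> v; rewrite /= -EFinM lee_fin indicE.
  case: (boolP (v \in _)) => [|_]; last by rewrite mulr_ge0// expR_ge0.
  rewrite inE => vz; rewrite /expl1 -expRD -[leLHS]expR0 ler_expR mul1r subr_ge0.
  apply: le_trans (sum_coord_le_norm v) _; rewrite ler_wpM2l//.
  by apply: HM vz; rewrite ltr_pwDr// le_max lexx orbT.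
rewrite (LintZl me e0) ?expR_ge0//.
apply: (@le_lt_trans _ _ ((expR K)%:E * ((2 / 1) ^+ n)%:E)%E).
  by rewrite lee_wpmul2l ?lee_fin ?expR_ge0//; exact: Lint_expl1.
by rewrite -EFinM ltry.
Qed.

End zono.

Lemma cross_proj_zono N n (w : 'rV[R]_n) c (Y : 'I_N -> 'rV[R]_n.+1) :
  [set cross_proj w z | z in zono c Y] = zono c (pfam w Y).
Proof.
have E (s : 'I_N -> R) : cross_proj w (\sum_j s j *: Y j) = \sum_j s j *: pfam w Y j.
  apply/rowP => i; rewrite !mxE !summxE mulr_suml -sumrB; apply: eq_bigr => j _.
  by rewrite !mxE; ring.
apply/seteqP; split => z /=.
  by move=> [_ [s sc ->] <-]; exists s.
by move=> [s sc ->]; exists (\sum_j s j *: Y j) => //; exists s.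
Qed.

Section inequality.
Variables (N n : nat) (Y : 'I_N -> 'rV[R]_n.+1) (w : 'I_N -> 'rV[R]_n).
Hypotheses (Y0 : forall j, Y j ord0 ord0 != 0) (wY : forall j, pfam (w j) Y j = 0).

(** Raising the [j]-th bound by [s] adds a segment along [Y j], whose half-length measured by the
    first coordinate is [s] times [|Y j ord0 ord0|]. *)
Lemma vol_zono_step (c c' : 'I_N -> R) (s : R) j : 0 <= s ->
  (forall i, c i + s * (i == j)%:R <= c' i) ->
  (vol (zono c Y) + (2 * (s * `|Y j ord0 ord0|))%:E * vol (zono c (pfam (w j) Y)) <=
   vol (zono c' Y))%E.
Proof.
move=> s0 cc; rewrite -cross_proj_zono; apply: vol_add_segment.
- by rewrite mulr_ge0.
- exact: mset_zono.
- exact: mset_zono.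
- by rewrite cross_proj_zono; exact: mset_zono.
- move=> p x y Bx By z /andP[xz zy].
  move: xz; rewrite le_eqVlt => /predU1P[<-//|xz].
  have yx : 0 < y - x by lra.
  have t01 : 0 <= (z - x) / (y - x) <= 1.
    by rewrite divr_ge0 ?ler_pdivrMr//; lra.
  have := zono_convex t01 Bx By; congr (zono _ _ _).
  have zE : z = (1 - (z - x) / (y - x)) * x + (z - x) / (y - x) * y.
    by field; rewrite gt_eqF.
  rewrite [in RHS]zE; set t := (z - x) / (y - x).
  apply/rowP => i; rewrite /coshear !rowcons0 !rtail_cons.
  by case: (unliftP ord0 i) => [k|] ->; rewrite !mxE ?liftK ?unlift_none/= ?mxE; ring.
- move=> z t [r rc ->] td; set a := Y j ord0 ord0 in td *.
  have YjE : Y j = a *: rowcons 1 (w j).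
    rewrite -[LHS]rowcons_tail -/a.
    have /eqP := wY j; rewrite /pfam subr_eq0 => /eqP ->.
    apply/rowP => i; rewrite -/a.
    by case: (unliftP ord0 i) => [k|] ->; rewrite !mxE ?liftK ?unlift_none/= ?mxE ?mulr1.
  have a0 : a != 0 by exact: Y0.
  (* [t] times the vector (1, [w j]) is [t / a] times [Y j]. *)
  exists (fun i => r i + t / a * (i == j)%:R).
    move=> i; apply: le_trans (ler_normD _ _) _; apply: le_trans (cc i).
    rewrite lerD// normrM normr_nat ler_wpM2r// normrM normfV.
    by rewrite ler_pdivrMr// normr_gt0.
  under [RHS]eq_bigr do rewrite scalerDl.
  rewrite big_split/=; congr (_ + _).
  rewrite (bigD1 j)//= eqxx mulr1 big1 ?addr0; last first.
    by move=> i /negbTE ->; rewrite mulr0 scale0r.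
  by rewrite YjE scalerA divfK.
Qed.

(** The segments are stretched one after the other. At each stage the projection of the current
    zonotope contains that of the original one, whose volume may therefore be used. *)
Lemma vol_zono_steps (s : R) : 0 <= s -> forall k, (k <= N)%N ->
  (vol (zono (fun=> 1%R) Y) + \sum_(j < N | (j < k)%N)
     (2 * (s * `|Y j ord0 ord0|))%:E * vol (zono (fun=> 1%R) (pfam (w j) Y)) <=
   vol (zono (fun j : 'I_N => 1 + s * (j < k)%N%:R)%R Y))%E.
Proof.
move=> s0; elim => [|k IH] kN.
  rewrite big_pred0 ?adde0//; apply: vol_le; [exact: mset_zono..|].
  by apply: zono_le => j; rewrite ltn0 mulr0 addr0.
pose jk := Ordinal kN.
rewrite (bigD1 jk)//= (eq_bigl (fun j : 'I_N => (j < k)%N)); last first.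
  move=> j; rewrite ltnS leq_eqVlt -val_eqE/=.
  by case: (ltngtP j k).
rewrite addeCA addeC.
apply: le_trans (@vol_zono_step (fun j : 'I_N => 1 + s * (j < k)%N%:R) _ s jk s0 _).
  apply: leeD; first exact: IH (ltnW kN).
  rewrite lee_wpmul2l ?lee_fin ?mulr_ge0//.
  apply: vol_le; [exact: mset_zono..|].
  by apply: zono_le => j; rewrite lerDl mulr_ge0.
move=> i; rewrite -addrA -mulrDr lerD2l ler_wpM2l// -natrD ler_nat.
by rewrite -val_eqE/= ltnS leq_eqVlt; case: (ltngtP i k).
Qed.

(** When all segments have been stretched, the result is the dilate by [1 + s], of volume
    [(1 + s)^(n + 1) V]. Then [expr1D_le] bounds the increase, and [s] is cancelled before the
    limit. *)
Lemma zono_section_inequality :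
  \sum_j 2 * `|Y j ord0 ord0| * fine (vol (zono (fun=> 1) (pfam (w j) Y))) <=
  n.+1%:R * fine (vol (zono (fun=> 1) Y)).
Proof.
set V := fine (vol (zono (fun=> 1) Y)); set S := \sum_j _.
have V0 : 0 <= V by rewrite fine_ge0// vol_ge0.
apply: (@le_scale_limit R n.+1); first by rewrite mulr_ge0.
move=> s /andP[s0 s1].
have := @vol_zono_steps s (ltW s0) N (leqnn N).
rewrite (eq_bigl xpredT); last by move=> j; exact: ltn_ord.
have -> : (fun j : 'I_N => 1 + s * (j < N)%N%:R) = (fun=> (1 + s) * 1).
  by apply/funext => j; rewrite ltn_ord !mulr1.
rewrite vol_zono_scale ?addr_gt0// -(fineK (vol_zono_fin _ Y)) -/V -EFinM.
rewrite (eq_bigr (fun j => (s * (2 * `|Y j ord0 ord0| *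
    fine (vol (zono (fun=> 1) (pfam (w j) Y)))))%:E)); last first.
  move=> j _; rewrite -[in LHS](fineK (vol_zono_fin _ _)) -EFinM; congr (_%:E); ring.
rewrite sumEFin -mulr_sumr -EFinD lee_fin -/S.
have := expr1D_le n.+1 (ltW s0); set p := (1 + s) ^+ n.+1; set q := n.+1%:R => bp H.
rewrite -(ler_pM2l s0).
have : p * V <= (1 + q * s * p) * V by rewrite ler_wpM2r.
lra.
Qed.

End inequality.

End zonotopes.

(** * Approximation by zonotopes *)

Section separation.
Context (R : realType) (n : nat).
Implicit Types (Z : set 'rV[R]_n) (x z : 'rV[R]_n).

Lemma dotp_ge0 x : 0 <= dotp x x.
Proof. by apply: sumr_ge0 => i _; rewrite -expr2 sqr_ge0. Qed.

Lemma dotp_eq0 x : dotp x x = 0 -> x = 0.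
Proof.
move=> /eqP; rewrite psumr_eq0; last by move=> i _; rewrite -expr2 sqr_ge0.
move=> /allP H; apply/rowP => i; rewrite mxE.
by have := H i (mem_index_enum i); rewrite /= mulf_eq0 orbb => /eqP.
Qed.

Lemma dotp_subZ x z t :
  dotp (x - t *: z) (x - t *: z) = dotp x x - 2 * t * dotp x z + t * t * dotp z z.
Proof. by rewrite dotpBl !dotpBr !dotpZl !dotpZr (dotpC z x); ring. Qed.

(* Minimize the Euclidean distance to [z0] over [Z]. *)
Lemma convex_separation Z z0 : Z !=set0 -> compact Z ->
  (forall x y t, 0 <= t <= 1 -> Z x -> Z y -> Z ((1 - t) *: x + t *: y)) ->
  (forall x c, (forall z, Z z -> dotp x z <= c) -> dotp x z0 <= c) -> Z z0.
Proof.
move=> Z0 cZ convZ Hsup.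
pose g z := dotp (z0 - z) (z0 - z).
have cg : continuous g.
  apply: continuous_sumr => i z.
  have c1 : continuous (fun z : 'rV[R]_n => (z0 - z) ord0 i).
    under eq_fun do rewrite !mxE.
    move=> u; apply: (@cvgB _ R^o); first exact: nbhs_filter.
      exact: cst_continuous.
    exact: coord_continuous.
  by apply: (@continuousM _ _ (fun z : 'rV[R]_n => (z0 - z) ord0 i)); exact: c1.
have [p] := EVT_min_rV Z0 cZ (continuous_subspaceT cg).
rewrite inE => Zp gp; pose d := z0 - p.
have Hd z : Z z -> dotp d z <= dotp d p.
  move=> Zz; rewrite -subr_le0 -dotpBr.
  have [//|dpos] := leP (dotp d (z - p)) 0.
  exfalso; have q0 := dotp_ge0 (z - p).
  (* With [t (b + 1) <= a], where [a = <d, z - p>] and [b = |z - p|^2], the change [- 2 t a + t^2 b]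
     of the squared distance is negative, against the minimality of [p]. The added 1 avoids a zero
     denominator. *)
  pose q := dotp (z - p) (z - p) + 1; have q1 : 0 < q by rewrite /q; lra.
  pose t := Num.min 1 (dotp d (z - p) / q).
  have t0 : 0 < t by rewrite /t lt_min ltr01 divr_gt0.
  have t1 : t <= 1 by rewrite /t ge_min lexx.
  have tq : t * q <= dotp d (z - p).
    by rewrite -ler_pdivlMr// /t ge_min lexx orbT.
  have Zt : Z ((1 - t) *: p + t *: z) by apply: convZ => //; rewrite (ltW t0) t1.
  have := gp _ (mem_set Zt); rewrite /g -/d.
  have -> : z0 - ((1 - t) *: p + t *: z) = d - t *: (z - p).
    by apply/rowP => i; rewrite !mxE; ring.
  rewrite dotp_subZ; move: tq dpos q0; rewrite /q.
  set a := dotp d (z - p); set b := dotp (z - p) (z - p) => tq a0 b0.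
  have : t * (t * (b + 1)) <= t * a by rewrite ler_wpM2l// ltW.
  have : 0 < t * t by rewrite mulr_gt0.
  have : 0 < t * a by rewrite mulr_gt0.
  lra.
have := Hsup d _ Hd; rewrite -subr_le0 -dotpBr -/d => dd.
have /dotp_eq0/eqP : dotp d d = 0 by apply/eqP; rewrite eq_le dd dotp_ge0.
by rewrite subr_eq0 => /eqP ->.
Qed.

End separation.

Section approximation.
Context (R : realType) (n N : nat).
Variables (Z : set 'rV[R]_n) (h : 'rV[R]_n -> R) (c d e : R) (Y : 'I_N -> 'rV[R]_n).
Hypotheses (Z0 : Z !=set0) (cZ : compact Z)
  (convZ : forall x y t, 0 <= t <= 1 -> Z x -> Z y -> Z ((1 - t) *: x + t *: y))
  (hZ : forall x b, (forall z, Z z -> dotp x z <= b) -> h x <= b)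
  (c0 : 0 < c) (hc : forall x, c * `|x| <= h x)
  (e01 : 0 < e <= 1) (de : 2 * d <= c * e)
  (Yh : forall x, `|hfam Y x - h x| <= d * `|x|).

(** The lower bound [c |x| <= h x] turns the absolute error [d |x|] into a relative error [e / 2],
    and [1 <= (1 + e) (1 - e / 2)] because [e <= 1]. *)
Lemma approx_le x : h x <= (1 + e) * hfam Y x.
Proof.
have /andP[e0 e1] := e01; have := Yh x; rewrite ler_norml => /andP[h1 h2].
have := hc x; have := normr_ge0 x; set u := `|x| in h1 h2 * => u0 cu.
have : 2 * d * u <= c * e * u by rewrite ler_wpM2r.
have : e * (c * u) <= e * h x by rewrite ler_wpM2l// ltW.
have : 0 <= c * u by rewrite mulr_ge0// ltW.
nra.
Qed.

Lemma approx_ge x : hfam Y x <= (1 + e) * h x.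
Proof.
have /andP[e0 e1] := e01; have := Yh x; rewrite ler_norml => /andP[h1 h2].
have := hc x; have := normr_ge0 x; set u := `|x| in h1 h2 * => u0 cu.
have : 2 * d * u <= c * e * u by rewrite ler_wpM2r.
have : e * (c * u) <= e * h x by rewrite ler_wpM2l// ltW.
have : 0 <= c * u by rewrite mulr_ge0// ltW.
nra.
Qed.

Lemma approx_spans : spans Y.
Proof.
move=> x hx; have := approx_le x; rewrite hx mulr0 => /(le_trans (hc x)).
by rewrite pmulr_rle0// normr_le0 => /eqP.
Qed.

(** By separation, the bound [hfam Y <= (1 + e) h] between support functions places the zonotope
    inside the dilate of [Z] by [1 + e]. *)
Lemma approx_vol : (vol (zono (fun=> 1%R) Y) <= ((1 + e) ^+ n)%:E * vol Z)%E.
Proof.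
have /andP[e0 e1] := e01; have e1' : 0 < 1 + e by rewrite addr_gt0.
have mZ : mset Z.
  by apply: closed_mrow; apply: compact_closed cZ; exact: norm_hausdorff.
have -> : ((1 + e) ^+ n = `|(1 + e)^-1| ^- n)%R.
  by rewrite gtr0_norm ?invr_gt0// exprVn invrK.
rewrite -(@vol_affine _ _ _ 0)//; last by rewrite invr_eq0 gt_eqF.
apply: vol_le; [exact: mset_zono|exact: mset_affine|].
move=> _ [s s1 ->] /=; rewrite addr0.
apply: convex_separation => // x b xb.
rewrite dotpZr ler_pdivrMl//; apply: le_trans (ler_wpM2l (ltW e1') (hZ xb)).
apply: le_trans (approx_ge x).
rewrite dotp_sumr; apply: ler_sum => j _; rewrite dotpZr.
apply: le_trans (ler_norm _) _; rewrite normrM ler_piMl//; exact: s1.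
Qed.

End approximation.

(** * The volume product of zonotopes *)

Section mahler_zonotope.
Context (R : realType).

(** The value [hfam Y x] is attained at the point of the zonotope whose coefficients are the signs
    of the inner products. *)
Lemma hfam_le_ub N n (Y : 'I_N -> 'rV[R]_n) x b :
  (forall z, zono (fun=> 1) Y z -> dotp x z <= b) -> hfam Y x <= b.
Proof.
move=> H; have := H (\sum_j Num.sg (dotp x (Y j)) *: Y j).
rewrite dotp_sumr (eq_bigr (fun j => `|dotp x (Y j)|)); last first.
  by move=> j _; rewrite dotpZr -normrEsg.
apply; exists (fun j => Num.sg (dotp x (Y j))) => // j.
by rewrite normr_sg lern1; case: (_ != _).
Qed.

(** Makes every [Y j] a multiple of some (1, w), zero vectors included. Each first coordinate moves
    by [k] or [- k], the sign being chosen so as not to cancel it, and the total error is at most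
    [N k |x|]. *)
Lemma perturb_family N n (Y : 'I_N -> 'rV[R]_n.+1) (d : R) : 0 < d ->
  exists Y' : 'I_N -> 'rV[R]_n.+1, (forall j, Y' j ord0 ord0 != 0) /\
    forall x, `|hfam Y' x - hfam Y x| <= d * `|x|.
Proof.
move=> d0; pose k := d / N.+1%:R.
have k0 : 0 < k by rewrite divr_gt0.
pose t j := if Y j ord0 ord0 == - k then - k else k.
have tk j : `|t j| <= k.
  by rewrite /t; case: ifP => _; rewrite ?normrN gtr0_norm.
exists (fun j => Y j + t j *: rowcons 1 0); split.
  move=> j; rewrite mxE mxE rowcons0 mulr1 /t.
  case: ifPn => [/eqP ->|]; last by rewrite addr_eq0.
  by rewrite -opprD oppr_eq0 gt_eqF// addr_gt0.
move=> x; rewrite /hfam -sumrB; apply: le_trans (ler_norm_sum _ _ _) _.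
apply: (@le_trans _ _ (\sum_(j < N) k * `|x|)).
  apply: ler_sum => j _; rewrite dotpDr dotpZr.
  apply: le_trans (ler_dist_dist _ _) _; rewrite addrC addKr normrM.
  apply: ler_pM => //.
  rewrite -[x]rowcons_tail dotp_rowcons mulr1 (dotpC _ 0) dotp0l addr0 rowcons_tail.
  exact: le_coord_norm.
rewrite sumr_const card_ord -mulr_natl mulrA ler_wpM2r// /k mulrCA.
by rewrite ler_piMr ?(ltW d0)// ler_pdivrMr// mul1r ler_nat.
Qed.

Theorem mahler_zonotope n N (Y : 'I_N -> 'rV[R]_n) : spans Y ->
  4 ^+ n <= fine (vol (zono (fun=> 1) Y)) * RLint (expfam Y).
Proof.
(* In dimension 0 the space is one point of mass 1, and both factors are 1. *)
elim: n N Y => [|n IH] N Y sY.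
  have z0 : zono (fun=> 1) Y 0.
    by exists (fun=> 0) => [j|]; rewrite ?normr0// big1// => j _; rewrite scale0r.
  rewrite vol_Lint; last exact: mset_zono.
  rewrite /RLint !Lint0/= indicE mem_set// /expfam /hfam big1 ?oppr0 ?expR0 ?mulr1//.
  by move=> j _; rewrite dotp0l normr0.
have nonzero (Y' : 'I_N -> 'rV[R]_n.+1) : spans Y' -> (forall j, Y' j ord0 ord0 != 0) ->
    4 ^+ n.+1 <= fine (vol (zono (fun=> 1) Y')) * RLint (expfam Y').
  move=> sY' Y'0; pose w j := (Y' j ord0 ord0)^-1 *: rtail (Y' j).
  have wY j : pfam (w j) Y' j = 0.
    by rewrite /pfam /w scalerA divff// scale1r subrr.
  have H1 := section_inequality sY' wY.
  have H2 := zono_section_inequality Y'0 wY.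
  have I0 := RLint_expfam_gt0 sY'.
  set V := fine _ in H2 *; set I := RLint _ in H1 I0 *.
  pose S := \sum_j `|Y' j ord0 ord0| / RLint (expfam (pfam (w j) Y')).
  rewrite -/S in H1.
  have H3 : 2 * 4 ^+ n * S <= n.+1%:R * V.
    apply: le_trans H2; rewrite mulr_sumr; apply: ler_sum => j _.
    have sj := @spans_pfam _ _ _ (w j) _ sY'.
    have Ij := RLint_expfam_gt0 sj; have := IH _ _ sj.
    rewrite -ler_pdivrMr// => IHj.
    have a0 : 0 <= 2 * `|Y' j ord0 ord0| by rewrite mulr_ge0.
    apply: le_trans (ler_wpM2l a0 IHj).
    by rewrite le_eqVlt; apply/orP; left; apply/eqP; ring.
  have n0 : 0 < n.+1%:R :> R by rewrite ltr0n.
  (* [H1] times [2 4^n] and [H3] times [I] share the quantity [2 4^n S I], which is eliminated; the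
     factor [n + 1] cancels. *)
  rewrite -(ler_pM2l n0) exprS.
  have p0 : 0 <= 2 * (4 : R) ^+ n by rewrite mulr_ge0// exprn_ge0.
  have := ler_wpM2l p0 H1; have := ler_wpM2r (ltW I0) H3.
  set p := 4 ^+ n; set q := n.+1%:R; lra.
have V0 : 0 <= fine (vol (zono (fun=> 1) Y)) by rewrite fine_ge0// vol_ge0.
have I0 := RLint_expfam_gt0 sY.
(* Perturbing the family costs [n + 1] factors [1 + e] for the volume and as many for the
   integral. *)
apply: (@le_scale_limit R (n.+1 + n.+1)); first by rewrite mulr_ge0// ltW.
move=> e e01; have /andP[e0 e1] := e01.
have [c c0 hc] := spans_ge sY.
have [Y' [Y'0 hY']] : exists Y' : 'I_N -> 'rV[R]_n.+1,
    (forall j, Y' j ord0 ord0 != 0) /\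
    forall x, `|hfam Y' x - hfam Y x| <= c * e / 2 * `|x|.
  by apply: perturb_family; rewrite divr_gt0// mulr_gt0.
have de : 2 * (c * e / 2) <= c * e by lra.
have sY' := approx_spans c0 hc e01 de hY'.
have ne : zono (fun=> 1) Y !=set0.
  by exists 0; exists (fun=> 0) => [j|]; rewrite ?normr0// big1// => j _; rewrite scale0r.
have Hvol := approx_vol ne (@compact_zono _ _ _ _ Y)
  (fun x y t t01 => zono_convex t01) (@hfam_le_ub _ _ Y) c0 hc e01 de hY'.
have Hint : RLint (expfam Y') <= (1 + e) ^+ n.+1 * RLint (expfam Y).
  have e1' : 0 < 1 + e by rewrite addr_gt0.
  rewrite -ler_pdivrMl ?exprn_gt0// -lee_fin -(Lint_expfam_scale sY' e1') -Lint_expfam//.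
  apply: ge0_le_Lint.
  - by move=> v; rewrite lee_fin expR_ge0.
  - apply: (@mrow_comp _ _ _ _ _ (EFin \o expfam Y') (fun v => (1 + e) *: v)).
      exact: scaler_continuous.
    by apply: mrow_EFin; exact: mrow_expfam.
  - by apply: mrow_EFin; exact: mrow_expfam.
  move=> v; rewrite lee_fin ler_expR lerN2 hfamZ gtr0_norm//.
  exact: (approx_le c0 hc e01 de hY').
have {}Hvol : fine (vol (zono (fun=> 1) Y')) <=
    (1 + e) ^+ n.+1 * fine (vol (zono (fun=> 1) Y)).
  by rewrite -lee_fin EFinM !fineK ?vol_zono_fin.
apply: le_trans (nonzero _ sY' Y'0) _.
have V'0 : 0 <= fine (vol (zono (fun=> 1) Y')) by rewrite fine_ge0// vol_ge0.
rewrite exprD mulrACA.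
exact: (ler_pM V'0 (ltW (RLint_expfam_gt0 sY')) Hvol Hint).
Qed.

End mahler_zonotope.

(** * Volume of a sublevel set *)

Section gamma_bound.
Context (R : realType).
Local Notation mu := (@lebesgue_measure R).

(** The integrand of Gamma(n + 1), extended by 0 to the whole line. *)
Definition gamma_weight n (s : R) : R := s ^+ n * expR (- s) * (0 < s)%R%:R.

Lemma gamma_weight_ge0 n s : 0 <= gamma_weight n s.
Proof.
rewrite /gamma_weight; have [s0|s0] := ltP 0 s; last by rewrite mulr0.
by rewrite mulr1 mulr_ge0 ?expR_ge0// exprn_ge0// ltW.
Qed.

Lemma measurable_gamma_weight n : measurable_fun [set: measurableTypeR R] (gamma_weight n).
Proof.
apply: measurable_funM.
  apply: measurable_funM; first exact: exprn_measurable.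
  by apply: measurableT_comp => //; exact: measurable_funN.
rewrite (_ : (fun s : R => (0 < s)%R%:R : R) = \1_(`]0, +oo[)).
  by apply: measurable_indic.
by apply/funext => x; rewrite indicE; congr ((nat_of_bool _)%:R);
   rewrite mem_setE in_itv/= andbT.
Qed.

(* Comparing with [s |-> gamma_weight n (s / (1 + e))] and letting [e] tend to 0. *)
Lemma integral_gamma_weight n : (\int[mu]_s (gamma_weight n s)%:E <= (n`!%:R)%:E)%E.
Proof.
have mg k : measurable_fun [set: measurableTypeR R] (EFin \o gamma_weight k).
  by apply/measurable_EFinP; exact: measurable_gamma_weight.
have g0 k s : (0 <= (EFin \o gamma_weight k) s)%E by rewrite lee_fin gamma_weight_ge0.
elim: n => [|n IH].
  rewrite fact0 -(@integral_exponential_pdf R 1)//.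
  apply: ge0_le_integral => //.
  - by move=> s _; exact: g0.
  - exact: mg.
  - by apply/measurable_EFinP; exact: measurable_exponential_pdf.
  move=> s _; rewrite lee_fin /gamma_weight expr0 mul1r.
  have [s0|s0] := ltP 0 s; last by rewrite mulr0 exponential_pdf_ge0.
  by rewrite mulr1 exponential_pdfE ?(ltW s0)// mul1r mulN1r.
have G0 k : (0 <= \int[mu]_s (gamma_weight k s)%:E)%E.
  by apply: integral_ge0 => s _; exact: g0.
have fin : (\int[mu]_s (gamma_weight n s)%:E)%E \is a fin_num.
  by rewrite ge0_fin_numE// (le_lt_trans IH)// ltry.
set G := fine (\int[mu]_s (gamma_weight n s)%:E)%E.
have GE : (\int[mu]_s (gamma_weight n s)%:E = G%:E)%E by rewrite fineK.
have step (e : R) : 0 < e <= 1 ->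
    (\int[mu]_s (gamma_weight n.+1 s)%:E <= ((1 + e) ^+ n.+2 * (n.+1%:R * G))%:E)%E.
  move=> /andP[e0 e1]; pose l := (1 + e)^-1.
  have e1' : 0 < 1 + e by rewrite addr_gt0.
  have l0 : 0 < l by rewrite invr_gt0.
  have l1 : l <= 1 by rewrite invf_le1//; lra.
  have lE : 1 - l = e * l by rewrite /l; field; rewrite gt_eqF.
  have l10 : 0 <= 1 - l by lra.
  have mgl : measurable_fun [set: measurableTypeR R]
      (fun s => (EFin \o gamma_weight n) (l * s + 0)).
    have := measurableT_comp (mg n) (measurable_affine l 0).
    exact.
  (* Obtained by integrating [exp(-l s) >= exp(-s) (1 + (1 - l) s)] against [s^n]. The inequality
     also yields the finiteness of the integral for [n + 1]. *)
  have key : (G%:E + (1 - l)%:E * \int[mu]_s (gamma_weight n.+1 s)%:E <=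
      (l ^- n * (l^-1 * G))%:E)%E.
    have -> : ((l ^- n * (l^-1 * G))%:E =
        (l ^- n)%:E * \int[mu]_s (EFin \o gamma_weight n) (l * s + 0)%R)%E.
      have ln0 : l != 0 by rewrite gt_eqF.
      rewrite (integral_affine 0 ln0 (mg n) (g0 n)).
      by rewrite gtr0_norm// EFinM; congr (_ * _)%E; rewrite EFinM -GE.
    rewrite -GE.
    have mgn := mg n; have mgn1 := mg n.+1.
    have g0n s : (0 <= (gamma_weight n s)%:E)%E := g0 n s.
    have g0n1 s : (0 <= (gamma_weight n.+1 s)%:E)%E := g0 n.+1 s.
    have g0l s : (0 <= (EFin \o gamma_weight n) (l * s + 0)%R)%E by exact: g0.
    have mlg : measurable_fun [set: measurableTypeR R]
        (fun s => (1 - l)%:E * (gamma_weight n.+1 s)%:E)%E by exact: measurable_funeM.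
    have lg0 s : (0 <= (1 - l)%:E * (gamma_weight n.+1 s)%:E)%E by rewrite mule_ge0.
    rewrite -ge0_integralZl_EFin//.
    rewrite -ge0_integralZl_EFin ?invr_ge0 ?exprn_ge0 ?(ltW l0)//.
    rewrite -ge0_integralD//.
    apply: ge0_le_integral => //.
    - by move=> s _; rewrite adde_ge0.
    - exact: emeasurable_funD.
    - exact: measurable_funeM.
    move=> s _; rewrite /= -!EFinM -EFinD lee_fin addr0 /gamma_weight.
    rewrite pmulr_rgt0//; have [s0|s0] := ltP 0 s; last by rewrite !mulr0 addr0.
    rewrite !mulr1 exprMn !mulrA mulVf ?expf_neq0 ?gt_eqF// mul1r exprS.
    have -> : - (l * s) = - s + (1 - l) * s by ring.
    rewrite expRD; have := @expR_ge1Dx R ((1 - l) * s).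
    have p0 : 0 <= s ^+ n * expR (- s) by rewrite mulr_ge0 ?expR_ge0// exprn_ge0// ltW.
    move: p0; set a := s ^+ n; set b := expR (- s); set c := expR _ => p0 H.
    have := ler_wpM2l p0 H; lra.
  have l1p : 0 < 1 - l by rewrite lE mulr_gt0.
  have fin1 : (\int[mu]_s (gamma_weight n.+1 s)%:E)%E \is a fin_num.
    rewrite ge0_fin_numE// ltey; apply/eqP => Goo.
    by move: key; rewrite Goo gt0_muley ?lte_fin// addey.
  move: key; rewrite -(fineK fin1) -EFinM -EFinD !lee_fin.
  set H := fine _; rewrite lE -exprVn mulrA -exprSr /l invrK => key.
  have G0' : 0 <= G by rewrite fine_ge0.
  have := ler_wpM2r G0' (expr1D_le n.+1 (ltW e0)).
  have key2 : (1 + e) * (G + e / (1 + e) * H) <= (1 + e) * ((1 + e) ^+ n.+1 * G).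
    by rewrite ler_pM2l.
  have E1 : (1 + e) * (G + e / (1 + e) * H) = (1 + e) * G + e * H.
    by field; rewrite gt_eqF.
  rewrite E1 in key2 => bern.
  have bern2 : (1 + e) * ((1 + e) ^+ n.+1 * G) <=
      (1 + e) * ((1 + n.+1%:R * e * (1 + e) ^+ n.+1) * G) by rewrite ler_pM2l.
  rewrite -(ler_pM2l e0) exprS.
  set p := (1 + e) ^+ n.+1 in key2 bern2 *; set q := n.+1%:R in bern2 *.
  lra.
have fin1 : (\int[mu]_s (gamma_weight n.+1 s)%:E)%E \is a fin_num.
  have := step 1; rewrite ltr01 lexx => /(_ isT) H.
  by rewrite ge0_fin_numE// (le_lt_trans H)// ltry.
have G0' : 0 <= G by rewrite fine_ge0.
rewrite -(fineK fin1) lee_fin; apply: (@le_trans _ _ (n.+1%:R * G)).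
  apply: (@le_scale_limit R n.+2); first by rewrite mulr_ge0.
  by move=> e e01; rewrite -lee_fin fineK//; exact: step.
by rewrite factS natrM ler_wpM2l// -lee_fin -GE.
Qed.

(** Beyond [a], [exp(-s)] is [exp(-a)] times the density of the standard exponential law translated
    by [a]. *)
Lemma integral_expR_tail (a : R) : 0 <= a ->
  (\int[mu]_s (expR (- s) * (a < s)%R%:R)%:E = (expR (- a))%:E)%E.
Proof.
move=> a0.
pose p := @exponential_pdf R 1.
have mp : measurable_fun [set: measurableTypeR R] (EFin \o p).
  by apply/measurable_EFinP; exact: measurable_exponential_pdf.
have p0 s : (0 <= (EFin \o p) s)%E by rewrite lee_fin exponential_pdf_ge0.
have -> : (\int[mu]_s (expR (- s) * (a < s)%R%:R)%:E =
    \int[mu]_(s in `]a, +oo[) (expR (- s))%:E)%E.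
  rewrite [RHS]integral_mkcond; apply: eq_integral => s _; rewrite patchE.
  by rewrite mem_setE in_itv/= andbT; case: ifP; rewrite ?mulr1 ?mulr0.
rewrite (integral_itv_obnd_cbnd (f := fun s => (expR (- s))%:E)); last first.
  apply: measurable_funTS; apply/measurable_EFinP.
  by apply: (measurableT_comp (@measurable_expR R)); exact: oppr_measurable.
rewrite -[RHS]mule1 -(@integral_exponential_pdf R 1)//.
have -> : (\int[mu]_s (p s)%:E = \int[mu]_s (EFin \o p) (1 * s + (- a))%R)%E.
  by rewrite integral_affine ?oner_eq0// normr1 invr1 mul1e.
rewrite -ge0_integralZl_EFin ?expR_ge0//; last first.
  exact: (measurableT_comp mp (measurable_affine 1 (- a))).
rewrite [LHS]integral_mkcond; apply: eq_integral => s _; rewrite patchE.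
rewrite mem_setE in_itv/= andbT mul1r; case: ifPn => [as_|].
  rewrite /p exponential_pdfE ?subr_ge0// mul1r mulN1r -EFinM -expRD.
  by congr (expR _)%:E; ring.
by rewrite -ltNge => sa; rewrite /p lt0_exponential_pdf ?subr_lt0// mule0.
Qed.

(** Integrate [exp(-s)] over the region [h x < s] in two orders: over [s] first it gives [exp(-h)],
    over [x] first the volume of a sublevel set, which scales as [s^n] and leaves a Gamma
    integral. *)
Lemma integral_exp_le_vol n (h : 'rV[R]_n -> R) : continuous h ->
  (forall x, 0 <= h x) -> (forall a x, h (a *: x) = `|a| * h x) ->
  (Lint (fun x => (expR (- h x))%:E) <= (n`!%:R)%:E * vol [set x | (h x <= 1)%R])%E.
Proof.
move=> ch h0 hZ.
pose E := [set v : 'rV[R]_n.+1 | h (rtail v) < v ord0 ord0].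
have mE : mset E.
  have mb : measurable_fun setT (fun t : n.+1.-tuple (measurableTypeR R) =>
     h (rtail (\row_i tnth t i)) < (\row_i tnth t i) ord0 ord0).
    apply: measurable_fun_ltr.
      apply: (@continuous_mrow R n.+1 (fun v => h (rtail v))) => v.
      by apply: (@continuous_comp _ _ _ (@rtail R n)); [exact: continuous_rtail|exact: ch].
    by apply: (@continuous_mrow R n.+1 (fun v => v ord0 ord0)); exact: coord_continuous.
  by have := mb measurableT [set true] I; rewrite setTI.
pose f (v : 'rV[R]_n.+1) : \bar R :=
  ((expR (- v ord0 ord0))%:E * (EFin \o (\1_E : _ -> R)) v)%E.
have f0 v : (0 <= f v)%E by rewrite /f mule_ge0// lee_fin ?expR_ge0.
have mf : mrow f.
  apply: emeasurable_funM; last exact: mrow_indic.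
  apply: (@mrow_EFin R n.+1 (fun v => expR (- v ord0 ord0))).
  apply: continuous_mrow => v.
  apply: (@continuous_comp _ _ _ (fun v : 'rV[R]_n.+1 => - v ord0 ord0) expR).
    by apply: (@continuousN _ R^o); exact: coord_continuous.
  exact: continuous_expR.
have mK s : mset [set x | h x <= s].
  apply: closed_mrow.
  exact: (@closed_comp _ _ h [set y | y <= s] (fun x _ => ch x) (@closed_le _ s)).
have mK' s : mset [set x | h x < s].
  apply: open_mrow.
  exact: (@open_comp _ _ h [set y | y < s] (fun x _ => ch x) (@open_lt _ s)).
have fE s x : f (rowcons s x) = ((expR (- s))%:E * (\1_[set x | (h x < s)%R] x)%:E)%E.
  by rewrite /f rowcons0/= !indicE /E; congr (_ * (nat_of_bool _)%:R%:E)%E;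
    apply/idP/idP; rewrite !inE/= rtail_cons rowcons0.
have -> : Lint (fun x => (expR (- h x))%:E) = Lint f.
  rewrite Lint_cons2//; apply: eq_Lint => x; rewrite -integral_expR_tail//.
  apply: eq_integral => s _; rewrite fE indicE EFinM; congr (_ * (nat_of_bool _)%:R%:E)%E.
  by apply/idP/idP; rewrite inE.
rewrite Lint_cons1//.
have V0 := vol_ge0 [set x | h x <= 1].
have mg : measurable_fun [set: measurableTypeR R] (EFin \o @gamma_weight n).
  by apply/measurable_EFinP; exact: measurable_gamma_weight.
apply: (@le_trans _ _ (\int[mu]_s
  ((EFin \o @gamma_weight n) s * vol [set x | (h x <= 1)%R]))%E); last first.
  rewrite ge0_integralZr//; last by move=> s _; rewrite lee_fin gamma_weight_ge0.
  by rewrite lee_wpmul2r//; exact: integral_gamma_weight.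
apply: ge0_le_integral => //.
- by move=> s _; exact: Lint_ge0.
- exact: measurable_Lint_slice.
- by apply: emeasurable_funM.
move=> s _; rewrite (eq_Lint (fE s)).
have i0 v : (0 <= (EFin \o (\1_[set x | (h x < s)%R] : _ -> R)) v)%E by rewrite lee_fin.
rewrite (LintZl (mrow_indic (mK' s)) i0) ?expR_ge0//.
rewrite -vol_Lint// /= /gamma_weight.
have [s0|s0] := ltP 0 s; last first.
  have -> : [set x | h x < s] = set0.
    apply/seteqP; split => // x /= hs; have := le_lt_trans (h0 x) hs.
    by rewrite ltNge s0.
  by rewrite /vol measure0 mule0 mulr0 mul0e.
rewrite mulr1 mulrC EFinM -muleA lee_wpmul2l ?lee_fin ?expR_ge0//.
have -> : ((s ^+ n) = `|s^-1| ^- n)%R.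
  by rewrite gtr0_norm ?invr_gt0// exprVn invrK.
rewrite -(@vol_affine _ _ _ 0)//; last by rewrite invr_eq0 gt_eqF.
apply: vol_le; [exact: mK'|by apply: mset_affine|].
move=> x /= hx; rewrite addr0 hZ gtr0_norm ?invr_gt0// ler_pdivrMl// mulr1.
exact: ltW.
Qed.

End gamma_bound.

(** * Discretization of a zonoid *)

Section discretization.
Context (R : realType) (n : nat).
Variable rho : {finite_measure set (borel_rV R n) -> \bar R}.

Lemma open_borel (U : set 'rV[R]_n) : open U -> measurable (U : set (borel_rV R n)).
Proof. by move=> oU; exact: sub_sigma_algebra. Qed.

Lemma continuous_borel (f : 'rV[R]_n -> R) : continuous f ->
  measurable_fun [set: borel_rV R n] (f : _ -> measurableTypeR R).
Proof.
move=> cf; apply: (measurability _ (RGenOpens.measurableE R)) => //.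
move=> _ [_ [a [b ->]] <-]; rewrite setTI; apply: open_borel.
by apply: open_comp => //; exact: interval_open.
Qed.

Lemma measurable_sphere : measurable (@sphere R n : set (borel_rV R n)).
Proof.
have ms : measurable_fun [set: borel_rV R n]
    ((fun x => dotp x x) : _ -> measurableTypeR R).
  apply: continuous_borel; apply: continuous_sumr => i x.
  by apply: (@continuousM _ _ (fun x : 'rV[R]_n => x ord0 i)); exact: coord_continuous.
rewrite (_ : @sphere R n = (fun x => dotp x x) @^-1` [set 1]).
  by rewrite -[X in measurable X]setTI; apply: ms => //; exact: measurable_set1.
apply/seteqP; split => x /=; last by move=> xx; rewrite /sphere/= xx sqrtr1.
move=> /(congr1 (fun r => r ^+ 2)); rewrite sqr_sqrtr ?expr1n//.
exact: dotp_ge0.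
Qed.

Lemma sphere_coord y i : @sphere R n y -> `|y ord0 i| <= 1.
Proof.
move=> /(congr1 (fun r => r ^+ 2)); rewrite expr1n sqr_sqrtr ?dotp_ge0// => y1.
rewrite -sqrtr_sqr -sqrtr1 ler_wsqrtr// -y1 /dotp (bigD1 i)//= -expr2 lerDl.
by apply: sumr_ge0 => j _; rewrite -expr2 sqr_ge0.
Qed.

Section grid.
Variable m : nat.
Hypothesis m0 : (0 < m)%N.
Let F := {ffun 'I_n -> 'I_(2 * m).+1}.

(** Coordinates on the sphere lie in [-1, 1], so [m (y_i + 1)] ranges over [0, 2 m]. The value [2 m]
    is reached at [y_i = 1], hence [2 m + 1] indices; half-open cells are disjoint. *)
Definition grid_cell (v : F) : set (borel_rV R n) := [set y | @sphere R n y /\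
  forall i, (v i)%:R <= m%:R * ((y : 'rV[R]_n) ord0 i + 1) < (v i).+1%:R].

Definition grid_point (v : F) : 'rV[R]_n := \row_i ((v i)%:R / m%:R - 1).

Lemma measurable_grid_cell v : measurable (grid_cell v).
Proof.
rewrite (_ : grid_cell v = @sphere R n `&` \bigcap_(i in [set: 'I_n])
    ((fun y : borel_rV R n => m%:R * ((y : 'rV[R]_n) ord0 i + 1) : measurableTypeR R) @^-1`
      `[(v i)%:R, (v i).+1%:R[%classic)).
  apply: measurableI; first exact: measurable_sphere.
  apply: fin_bigcap_measurable => // i _.
  have cf : continuous (fun y : 'rV[R]_n => m%:R * (y ord0 i + 1)).
    have c1 : continuous (fun y : 'rV[R]_n => y ord0 i + 1).
      move=> y; apply: (@continuousD _ R^o); first exact: coord_continuous.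
      exact: cst_continuous.
    move=> y; apply: (@continuousM _ _ (fun _ : 'rV[R]_n => m%:R : R)); last exact: c1.
    exact: cst_continuous.
  by rewrite -[X in measurable X]setTI; apply: (continuous_borel cf).
apply/seteqP; split => y /=.
  by move=> [sy Hy]; split => // i _; rewrite /= in_itv/=; exact: Hy.
by move=> [sy Hy]; split => // i; have := Hy i I; rewrite /= in_itv.
Qed.

Lemma grid_cover : @sphere R n = \big[setU/set0]_(v <- enum F) grid_cell v.
Proof.
apply/seteqP; split => y.
  move=> sy; rewrite -bigcup_seq.
  have /all_sig[k kP] i : {k : 'I_(2 * m).+1 |
      (k%:R : R) <= m%:R * (y ord0 i + 1) < k.+1%:R}.
    have := sphere_coord i sy; rewrite ler_norml => /andP[y1 y2].
    have r0 : 0 <= m%:R * (y ord0 i + 1) by rewrite mulr_ge0//; lra.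
    have /andP[t1 t2] := truncn_itv r0.
    have km : (Num.truncn (m%:R * (y ord0 i + 1)) < (2 * m).+1)%N.
      rewrite ltnS -(ler_nat R) (le_trans t1)// natrM mulrC ler_wpM2r//.
      lra.
    by exists (Ordinal km); rewrite t1 t2.
  exists [ffun i => k i]; first by rewrite /= mem_enum.
  by split => // i; rewrite ffunE; exact: kP.
by rewrite -bigcup_seq => -[v _ []].
Qed.

Lemma grid_trivIset (D : set F) : trivIset D grid_cell.
Proof.
move=> u v _ _ [y [[_ yu] [_ yv]]]; apply/ffunP => i; apply/val_inj => /=.
have /andP[u1 u2] := yu i; have /andP[v1 v2] := yv i.
have := le_lt_trans u1 v2; have := le_lt_trans v1 u2.
rewrite !ltr_nat !ltnS => vu uv.
by apply/eqP; rewrite eqn_leq uv vu.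
Qed.

Lemma grid_dist v y x : grid_cell v y ->
  Num.norm (`|dotp x y| - `|dotp x (grid_point v)|) <= n%:R * `|x| / m%:R.
Proof.
move=> [_ yv]; apply: le_trans (ler_dist_dist _ _) _; rewrite -dotpBr.
apply: le_trans (ler_norm_sum _ _ _) _.
apply: (@le_trans _ _ (\sum_i `|x ord0 i| / m%:R)).
  apply: ler_sum => i _; rewrite normrM ler_wpM2l// !mxE.
  have /andP[v1 v2] := yv i.
  have mp : 0 < m%:R :> R by rewrite ltr0n.
  rewrite ler_norml; apply/andP; split.
    rewrite -(ler_pM2l mp) mulrN mulfV ?gt_eqF//.
    have -> : m%:R * (y ord0 i - ((v i)%:R / m%:R - 1)) =
       m%:R * (y ord0 i + 1) - (v i)%:R :> R by field; rewrite gt_eqF.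
    lra.
  rewrite -(ler_pM2l mp) mulfV ?gt_eqF//.
  have -> : m%:R * (y ord0 i - ((v i)%:R / m%:R - 1)) =
     m%:R * (y ord0 i + 1) - (v i)%:R :> R by field; rewrite gt_eqF.
  move: v2; rewrite -natr1; lra.
rewrite -mulr_suml ler_wpM2r ?invr_ge0//.
exact: sum_coord_le_norm.
Qed.

(** On a cell the integrand stays within [eta] of its value at the grid point, and the masses of the
    cells sum to at most the total mass. *)
Lemma grid_approx (h : R) x :
  (h%:E = \int[rho]_(y in @sphere R n) `|dotp x y|%:E)%E ->
  `|\sum_(v : F) fine (rho (grid_cell v)) * `|dotp x (grid_point v)| - h| <=
  fine (rho setT) * (n%:R * `|x| / m%:R).
Proof.
move=> hE; set eta := n%:R * `|x| / m%:R.
have eta0 : 0 <= eta by rewrite divr_ge0// mulr_ge0.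
have mf : measurable_fun [set: borel_rV R n]
    (fun y => (`|dotp x y|)%:E : \bar R).
  apply/measurable_EFinP; apply: measurableT_comp => //.
  apply: (continuous_borel (f := fun y => dotp x y)).
  by under eq_fun do rewrite dotpC; exact: continuous_dotpl.
have mS D : measurable_fun D (fun y : borel_rV R n => (`|dotp x y|)%:E : \bar R).
  exact: measurable_funS mf.
have fin v : rho (grid_cell v) \is a fin_num.
  by apply: fin_num_measure; exact: measurable_grid_cell.
have sumI (f : borel_rV R n -> \bar R) : measurable_fun setT f -> (forall y, 0 <= f y)%E ->
    (\int[rho]_(y in @sphere R n) f y = \sum_(v : F) \int[rho]_(y in grid_cell v) f y)%E.
  move=> mf0 f0; rewrite grid_cover ge0_integral_bigsetU//.
  - by rewrite big_enum.
  - by move=> v; exact: measurable_grid_cell.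
  - exact: enum_uniq.
  - exact: grid_trivIset.
  - exact: measurable_funS mf0.
have mass : \sum_(v : F) fine (rho (grid_cell v)) <= fine (rho setT).
  rewrite -lee_fin -sumEFin fineK; last exact: fin_num_measure.
  under eq_bigr do rewrite fineK//.
  have := sumI (cst 1%E) _ _; rewrite integral_cst ?mul1e; last exact: measurable_sphere.
  move=> E; rewrite (eq_bigr (fun v => (\int[rho]_(y in grid_cell v) cst 1 y)%E)).
    rewrite -E//; apply: le_measure; rewrite ?inE//; exact: measurable_sphere.
  by move=> v _; rewrite integral_cst ?mul1e//; exact: measurable_grid_cell.
pose c v := `|dotp x (grid_point v)|.
pose r v := fine (rho (grid_cell v)).
have r0 v : 0 <= r v by rewrite fine_ge0.
have bnd v y : grid_cell v y -> `|dotp x y| <= c v + eta /\ c v <= `|dotp x y| + eta.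
  move=> /(grid_dist x); rewrite -/(c v) -/eta ler_norml => /andP[h1 h2].
  by split; lra.
have up v : (\int[rho]_(y in grid_cell v) `|dotp x y|%:E <= ((c v + eta) * r v)%:E)%E.
  rewrite EFinM fineK// -integral_cst; last exact: measurable_grid_cell.
  apply: ge0_le_integral => //; first exact: measurable_grid_cell.
  by move=> y yv; rewrite lee_fin; have [] := bnd v y yv.
have I0 v : (0 <= \int[rho]_(y in grid_cell v) `|dotp x y|%:E)%E.
  by apply: integral_ge0.
have Ifin v : (\int[rho]_(y in grid_cell v) `|dotp x y|%:E)%E \is a fin_num.
  by rewrite ge0_fin_numE// (le_lt_trans (up v))// ltry.
have low v : ((c v * r v)%:E <=
    \int[rho]_(y in grid_cell v) `|dotp x y|%:E + (eta * r v)%:E)%E.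
  rewrite !EFinM fineK// -!integral_cst; try exact: measurable_grid_cell.
  rewrite -ge0_integralD//; try exact: measurable_grid_cell.
  apply: ge0_le_integral => //; first exact: measurable_grid_cell.
  - by move=> y _; rewrite lee_fin normr_ge0.
  - by apply: emeasurable_funD.
  by move=> y yv; rewrite -EFinD lee_fin; have [] := bnd v y yv.
pose I v := fine (\int[rho]_(y in grid_cell v) `|dotp x y|%:E)%E.
have hI : h = \sum_(v : F) I v.
  apply: EFin_inj; rewrite hE sumI// -sumEFin.
  by apply: eq_bigr => v _; rewrite fineK.
rewrite hI -sumrB; apply: le_trans (ler_norm_sum _ _ _) _.
apply: le_trans (ler_wpM2r eta0 mass); rewrite mulr_suml.
apply: ler_sum => v _; rewrite -/(c v) -/(r v).
have := up v; have := low v; rewrite -(fineK (Ifin v)) -/(I v) -EFinD !lee_fin => H1 H2.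
rewrite ler_norml; apply/andP; split; lra.
Qed.

End grid.

(** The mass of a cell, being nonnegative, is absorbed into the vector: [Y j] is the grid point
    scaled by it. The mesh [m] is taken above [M / d] to bring the error down to [d |x|]. *)
Lemma discretize (h : 'rV[R]_n -> R) (d : R) : 0 < d ->
  (forall x, (h x)%:E = \int[rho]_(y in @sphere R n) `|dotp x y|%:E)%E ->
  exists N (Y : 'I_N -> 'rV[R]_n), forall x, `|hfam Y x - h x| <= d * `|x|.
Proof.
move=> d0 hE; pose M := fine (rho setT) * n%:R.
have M0 : 0 <= M by rewrite mulr_ge0// fine_ge0.
pose m := (Num.truncn (M / d)).+1.
have mM : M / d < m%:R.
  by have /andP[_] := truncn_itv (divr_ge0 M0 (ltW d0)).
pose F := {ffun 'I_n -> 'I_(2 * m).+1}.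
exists #|F|, (fun j => fine (rho (grid_cell (enum_val j))) *: grid_point (enum_val j)).
move=> x; have := grid_approx (isT : (0 < m)%N) (hE x).
rewrite /hfam (eq_bigr (fun j : 'I_#|F| => fine (rho (grid_cell (enum_val j))) *
    `|dotp x (grid_point (enum_val j))|)); last first.
  by move=> j _; rewrite dotpZr normrM ger0_norm// fine_ge0.
rewrite -(big_enum_val (A := F) (fun v => fine (rho (grid_cell v)) * `|dotp x (grid_point v)|)).
move=> /le_trans; apply.
rewrite (_ : fine _ * _ = M / m%:R * `|x|); last by rewrite /M; ring.
rewrite ler_wpM2r// ler_pdivrMr ?ltr0n// mulrC -ler_pdivrMr//.
exact: ltW.
Qed.

End discretization.

(** * From zonotopes to zonoids *)

Section full_dimension.
Context (R : realType) (n : nat).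
Variable Z : set 'rV[R]_n.

(** The affine hull is the whole space, so [x] is itself a combination of points of [Z], whence
    [<x, x> = 0]. *)
Lemma has_dim_orthogonal x : has_dim Z n -> (forall z, Z z -> dotp x z = 0) -> x = 0.
Proof.
move=> [p [V [aff dimV]]] xZ; apply: dotp_eq0.
have VT : V = fullv.
  apply/eqP; rewrite eqEdim subvf dimV dimvf/=.
  by rewrite /dim/= mul1n.
have : affine_hull Z x by rewrite aff; exists (x - p); rewrite ?VT/= ?memvf// addrC subrK.
move=> [k [c [a [Za _ xE]]]].
rewrite {2}xE dotp_sumr big1// => i _.
by rewrite dotpZr xZ ?mulr0.
Qed.

End full_dimension.

Section support_function.
Context (R : realType) (n : nat).
Variable Z : set 'rV[R]_n.
Hypotheses (Z0 : Z !=set0) (cZ : compact Z).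
Local Notation h := (support_fun Z).

Lemma support_fun_le x b : (forall z, Z z -> dotp x z <= b) -> h x <= b.
Proof.
move=> H; apply: ge_sup; first by have [z Zz] := Z0; exists (dotp x z); exists z.
by move=> _ [z Zz <-]; exact: H.
Qed.

Lemma le_support_fun x z : Z z -> dotp x z <= h x.
Proof.
move=> Zz; apply: ub_le_sup; last by exists z.
have [M [_ HM]] := compact_bounded cZ.
exists (n%:R * `|x| * (M + 1)) => _ [u Zu <-].
apply: le_trans (ler_norm _) _; apply: le_trans (normr_dotp_le _ _) _.
rewrite ler_wpM2l ?mulr_ge0//; apply: (HM (M + 1)) => //.
by rewrite ltrDl.
Qed.

(** A bound on [Z] makes [h] Lipschitz; the added 1 in [K] keeps the constant positive. *)
Lemma continuous_support_fun : continuous h.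
Proof.
have [M [_ HM]] := compact_bounded cZ.
pose K := n%:R * (Num.max 0 M + 1) + 1.
have M1 : 0 <= Num.max 0 M + 1 by rewrite addr_ge0// le_max lexx.
have K0 : 0 < K by rewrite ltr_wpDl// mulr_ge0.
have lip x y : h x - h y <= K * `|x - y|.
  rewrite lerBlDl; apply: support_fun_le => z Zz.
  rewrite -[x in dotp x z](subrK y) dotpDl addrC lerD ?le_support_fun//.
  apply: le_trans (ler_norm _) _; apply: le_trans (normr_dotp_le _ _) _.
  rewrite mulrAC ler_wpM2r//.
  apply: (@le_trans _ _ (n%:R * (Num.max 0 M + 1))); last by rewrite lerDl.
  rewrite ler_wpM2l//; apply: (HM (Num.max 0 M + 1)) => //.
  by rewrite ltr_pwDr// le_max lexx orbT.
move=> x; apply/(@cvgrPdist_lt _ R^o (matrix R 1 n) (nbhs x) (nbhs_filter x)) => e e0.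
near=> y.
have : `|x - y| < e / K.
  near: y; have := nbhsx_ballx x (e / K) (divr_gt0 e0 K0).
  by rewrite mx_norm_ball.
rewrite ltr_pdivlMr// mulrC => xy; apply: le_lt_trans xy.
rewrite ler_norml lip andbT lerNl opprB distrC; exact: lip.
Unshelve. all: by end_near. Qed.

End support_function.

Theorem corollary3p1 (R : realType) (n : nat) (n_ge1 : (1 <= n)%N)
    (Z : set 'rV[R]_n) (zonoidZ : zonoid Z) (dimZ : has_dim Z n) :
  ((4 ^+ n / n`!%:R)%:E <= vol Z * vol (polar Z))%E.
Proof.
have [Z0 cZ cvZ [rho [[rho0 rhoE] hE]]] := zonoidZ.
pose h := support_fun Z.
have hZ := support_fun_le Z0.
have Zh := le_support_fun cZ.
have ch := continuous_support_fun Z0 cZ.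
have convZ x y t : 0 <= t <= 1 -> Z x -> Z y -> Z ((1 - t) *: x + t *: y).
  move=> /andP[t0 t1] Zx Zy.
  have := cvZ y x (Itv01 t0 t1) (mem_set Zy) (mem_set Zx).
  by rewrite inE/= /conv/= addrC.
(* The integral representation gives homogeneity with [|a|], hence also evenness. *)
have hhom a x : h (a *: x) = `|a| * h x.
  apply: EFin_inj; rewrite EFinM /h !hE.
  rewrite -ge0_integralZl_EFin//.
  - by apply: eq_integral => y _; rewrite dotpZl normrM EFinM.
  - exact: measurable_sphere.
  - apply/measurable_EFinP; apply: measurableT_comp => //; apply: measurable_funTS.
    apply: (continuous_borel (f := fun y => dotp x y)).
    by under eq_fun do rewrite dotpC; exact: continuous_dotpl.
have hN x : h (- x) = h x by rewrite -scaleN1r hhom normrN1 mul1r.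
have h_ge0 x : 0 <= h x.
  by rewrite -lee_fin /h hE; apply: integral_ge0.
(* If [h x = 0], evenness bounds [<x, z>] by 0 from both sides for all [z] in [Z], and full
   dimension gives [x = 0]. *)
have hpos x : x != 0 -> 0 < h x.
  move=> x0; rewrite lt_neqAle h_ge0 andbT eq_sym; apply: contraNneq x0 => hx.
  apply/eqP; apply: (has_dim_orthogonal dimZ) => z Zz.
  apply/eqP; rewrite eq_le -{1}hx Zh//=.
  have := Zh (- x) z Zz; rewrite -/h hN hx -scaleN1r dotpZl; lra.
have [c c0 hc] := homogeneous_ge_norm ch hhom hpos.
have mZ : mset Z.
  by apply: closed_mrow; apply: compact_closed cZ; exact: norm_hausdorff.
have mP : mset (polar Z).
  apply: closed_mrow; rewrite (_ : polar Z = \bigcap_(z in Z) [set y | dotp z y <= 1]).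
    apply: closed_bigI => z _.
    have cd : continuous (dotp z).
      rewrite (_ : dotp z = fun y => dotp y z); first exact: continuous_dotpl.
      by apply/funext => y; exact: dotpC.
    exact: (@closed_comp _ _ (dotp z) [set y | y <= 1] (fun x _ => cd x) (@closed_le _ 1)).
  by apply/seteqP; split.
have [->|Pfin] := eqVneq (vol Z * vol (polar Z))%E +oo%E; first by rewrite leey.
have P0 : (0 <= vol Z * vol (polar Z))%E by rewrite mule_ge0// vol_ge0.
have PE : (vol Z * vol (polar Z))%E \is a fin_num by rewrite ge0_fin_numE// ltey.
rewrite -(fineK PE) lee_fin.
(* [n] factors [1 + e] come from the volume of the zonotope and [n] from that of its polar. *)
apply: (@le_scale_limit R (n + n)); first by rewrite fine_ge0.
move=> e e01; have /andP[e0 e1] := e01; have e1' : 0 < 1 + e by rewrite addr_gt0.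
have [N [Y hY]] : exists N (Y : 'I_N -> 'rV[R]_n),
    forall x, `|hfam Y x - h x| <= c * e / 2 * `|x|.
  by apply: (discretize (rho := rho)) => //; rewrite divr_gt0// mulr_gt0.
have de : 2 * (c * e / 2) <= c * e by lra.
have sY := approx_spans c0 hc e01 de hY.
have Hvol := approx_vol Z0 cZ convZ hZ c0 hc e01 de hY.
(* As [h <= (1 + e) hfam Y], the polar of the zonotope lies in the dilate of [polar Z] by
   [1 + e]. *)
have Hpol : (vol [set x | (hfam Y x <= 1)%R] <= ((1 + e) ^+ n)%:E * vol (polar Z))%E.
  have -> : ((1 + e) ^+ n = `|(1 + e)^-1| ^- n)%R.
    by rewrite gtr0_norm ?invr_gt0// exprVn invrK.
  rewrite -(@vol_affine _ _ _ 0)//; last by rewrite invr_eq0 gt_eqF.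
  apply: vol_le; [|exact: mset_affine|].
    apply: closed_mrow.
    exact: (@closed_comp _ _ (hfam Y) [set y | y <= 1]
      (fun x _ => @continuous_hfam _ _ _ Y x) (@closed_le _ 1)).
  move=> x /= hx1 z Zz; rewrite addr0 dotpC dotpZl ler_pdivrMl// mulr1.
  apply: le_trans (Zh x z Zz) _; apply: le_trans (approx_le c0 hc e01 de hY x) _.
  by rewrite ler_piMr// ltW.
have HI : ((RLint (expfam Y))%:E <=
    (n`!%:R)%:E * vol [set x | (hfam Y x <= 1)%R])%E.
  rewrite -Lint_expfam//; apply: integral_exp_le_vol.
  - exact: continuous_hfam.
  - exact: hfam_ge0.
  - exact: hfamZ.
have I0 := ltW (RLint_expfam_gt0 sY).
have nf : 0 < n`!%:R :> R by rewrite ltr0n fact_gt0.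
rewrite ler_pdivrMr// -lee_fin; apply: (@le_trans _ _
  (vol (zono (fun=> 1%R) Y) * (RLint (expfam Y))%:E)%E).
  by rewrite -(fineK (vol_zono_fin _ Y)) -EFinM lee_fin; exact: mahler_zonotope.
apply: (@le_trans _ _ ((((1 + e) ^+ n)%:E * vol Z) *
   ((n`!%:R)%:E * (((1 + e) ^+ n)%:E * vol (polar Z))))%E).
  apply: lee_pmul; [exact: vol_ge0|by rewrite lee_fin|exact: Hvol|].
  by apply: le_trans HI _; rewrite lee_wpmul2l// lee_fin; exact: ltW.
rewrite [in leLHS](muleCA (n`!%:R)%:E) muleACA (muleCA (vol Z)) -EFinM -exprD.
by rewrite -mulrA EFinM (mulrC (fine _)) EFinM fineK.
Qed.
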